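(* Let $\alpha \in (0,1)$. There exists a nonempty open interval $I \subseteq [0,1]$ such that the set of functions $f:[0,1]\to\mathbb{R}$ that are nowhere fractional differentiable on $I$ of order $q$ for every $q\in(\alpha,1)$ and fractional differentiable on $I$ of order $q$ for every $q\in(0,\alpha)$ is strongly $\mathfrak{c}$-algebrable.
   Context: Fractional differentiability: let $I\subseteq\mathbb{R}$ be an open interval, $f:I\to\mathbb{R}$ and $0<q<1$. The Riemann–Liouville fractional derivative of order $q$ of $f$ at $a\in I$ is $$\frac{d^q f(x)}{[d(x-a)]^q} := \frac{1}{\Gamma(1-q)}\,\frac{d}{dx}\int_a^x \frac{f(y)}{(x-y)^q}\,dy ,$$ a function of $x\in I$, $x>a$, where it exists ($\Gamma$ is the Gamma function). The local fractional derivative of order $q$ of $f$ at $a$ is $$\mathbb{D}^q f(a) := \lim_{x\to a}\frac{d^q(f(x)-f(a))}{[d(x-a)]^q},$$ i.e. the limit as $x\to a$ (through $x>a$) of $\frac{1}{\Gamma(1-q)}\,\frac{d}{dx}\int_a^x \frac{f(y)-f(a)}{(x-y)^q}\,dy$, provided the limit exists and is finite; in that case $f$ is called locally fractional differentiable of order $q$ at $a$. The function $f$ is fractional differentiable of order $q$ on $I$ if it is locally fractional differentiable of order $q$ at every $a\in I$, and nowhere fractional differentiable of order $q$ on $I$ if it is not locally fractional differentiable of order $q$ at any $a\in I$. For $f:[0,1]\to\mathbb{R}$ and $I\subseteq[0,1]$, these notions on $I$ refer to the restriction $f|_I$. Strong algebrability: for a commutative algebra $\mathcal{A}$ (here the functions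 $[0,1]\to\mathbb{R}$ with pointwise operations) and a cardinal $\kappa$, a subset $\mathcal{B}\subseteq\mathcal{A}$ is strongly $\kappa$-algebrable if there is a $\kappa$-generated free algebra contained in $\mathcal{B}\cup\{0\}$, i.e. there is a set $X\subseteq\mathcal{A}$ of cardinality $\kappa$ such that (1) the subalgebra generated by $X$ (all $P(x_1,\dots,x_n)$ with $x_1,\dots,x_n\in X$ and $P$ a real polynomial without constant term) is contained in $\mathcal{B}\cup\{0\}$, and (2) $X$ is free: for every polynomial $P$ without constant term and any distinct $x_1,\dots,x_n\in X$, $P(x_1,\dots,x_n)=0$ if and only if $P=0$. $\mathfrak{c}$ is the cardinality of $\mathbb{R}$. *)

(* Defs.v *)
From HB Require Import structures.
From mathcomp Require Import all_boot all_order all_algebra.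
From mathcomp Require Import all_classical all_reals all_analysis.
(* Only the algebraic structures of [mpoly] are imported: its notations clash
   with those of analysis. *)
From mathcomp Require Import (canonicals) mpoly.

Set Implicit Arguments.
Unset Strict Implicit.
Unset Printing Implicit Defensive.

Import Order.TTheory GRing.Theory Num.Theory.
Import numFieldNormedType.Exports.

Local Open Scope classical_set_scope.
Local Open Scope ring_scope.

Section fractional_derivative.
Context {R : realType}.
Implicit Types (q s a x : R) (f : R -> R) (I : set R).

(* Euler's integral; the integral is finite for [0 < s]. *)
Definition Gamma s : R :=
  \int[lebesgue_measure]_(t in `]0, +oo[) (t `^ (s - 1) * expR (- t)).

Definition RL_kernel q f x : R -> R := fun y => f y / (x - y) `^ q.

Definition RL_integral q f a x : R :=
  \int[lebesgue_measure]_(y in `]a, x[) RL_kernel q f x y.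

(* [Rintegral] is total, so that the integrals exist has to be required
   separately, here for all upper bounds [z] near [x]. *)
Definition RL_derivable q f a x : Prop :=
  (\forall z \near x,
     lebesgue_measure.-integrable `]a, z[ (EFin \o RL_kernel q f z)) /\
  derivable (RL_integral q f a) x 1.

Definition RL_derivative q f a x : R :=
  (Gamma (1 - q))^-1 * derive1 (RL_integral q f a) x.

(* The limit is the one-sided limit as [x] tends to [a] through [x > a], so the
   Riemann-Liouville derivative must exist on some [`]a, a + e[]. Only the
   values of [f] on some [`[a, a + e[] matter: for [a] in an open interval [I],
   this is a notion about the restriction of [f] to [I]. *)
Definition locally_frac_differentiable q f a : Prop :=
  let g := fun y => f y - f a in
  (\forall x \near a^'+, RL_derivable q g a x) /\
  cvg (RL_derivative q g a x @[x --> a^'+]).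

Definition frac_differentiable_on q f I : Prop :=
  forall a, I a -> locally_frac_differentiable q f a.

Definition nowhere_frac_differentiable_on q f I : Prop :=
  forall a, I a -> ~ locally_frac_differentiable q f a.

End fractional_derivative.

Section strong_algebrability.
Context {R : realType} {T : Type}.
Implicit Types (B X : set (T -> R)) (n : nat).

Definition poly_fun n (P : mpoly.mpoly n R) (x : 'I_n -> T -> R) : T -> R :=
  fun t => mpoly.meval (fun i => x i t) P.

Definition no_constant_term n (P : mpoly.mpoly n R) : Prop :=
  mpoly.mcoeff (@mpoly.mnm0 n) P = 0.

Definition generated_subalgebra X : set (T -> R) :=
  [set g | exists n (P : mpoly.mpoly n R) (x : 'I_n -> T -> R),
     [/\ no_constant_term P, forall i, X (x i) & g = poly_fun P x]].

Definition free_set X : Prop :=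
  forall n (P : mpoly.mpoly n R) (x : 'I_n -> T -> R),
    no_constant_term P -> (forall i, X (x i)) -> injective x ->
    (poly_fun P x = cst 0 <-> P = 0).

(* The cardinal is given by a set [K] of that cardinality. *)
Definition strongly_algebrable (U : Type) (K : set U) B : Prop :=
  exists X : set (T -> R),
    [/\ (X #= K)%card, generated_subalgebra X `<=` B `|` [set cst 0] & free_set X].

End strong_algebrability.

(* Main.v *)
(* Let (r_n) enumerate the rationals and let
   f x = sum_n clamp (x - r_n) ^ alpha / n!, where clamp truncates to [0, 1].
   Then f is strictly increasing, alpha-Hoelder, and
   f (r_n + t) - f r_n >= t ^ alpha / n! for 0 <= t <= 1.
   The free generators are exp (b_c f), for c real, where b_c is the sum of the
   1 / n! over the n with r_n < c; the b_c are linearly independent over the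
   integers, so that monomials have distinct exponents and the nonzero elements
   of the algebra are the G o f, with G a nonzero exponential sum with positive
   exponents.
   - G o f is alpha-Hoelder, so for q < alpha the derivative of the
     Riemann-Liouville integral at x is given by Marchaud's formula and is
     O((x - a) ^ (alpha - q)).
   - By Rolle's theorem G' has a constant sign on the right of every point, so G o f
     is monotone on the right of every a; at a rational r close to a, the
     increments of the Riemann-Liouville integral of order q > alpha all have
     the same sign and are at least of order t ^ (1 + alpha - q), so that the
     integral is not differentiable at r. *)
Require Import Defs.
From mathcomp Require Import all_boot all_order all_algebra.
From mathcomp Require Import all_classical all_reals all_analysis.
From mathcomp Require Import measurable_realfun.
From mathcomp Require Import (canonicals) mpoly.
From mathcomp Require Import ring lra zify.

Set Implicit Arguments.
Unset Strict Implicit.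
Unset Printing Implicit Defensive.

Import Order.TTheory GRing.Theory Num.Theory.
Import numFieldNormedType.Exports.

Local Open Scope classical_set_scope.
Local Open Scope ring_scope.

(** * Integrals of powers with an endpoint singularity *)

Section powR_integrals.
Context {R : realType}.
Local Notation mu := (@lebesgue_measure R).
Implicit Types (a b c x s M : R) (f : R -> R).

Lemma is_derive_powR_sub x s y : s != 0 -> y < x ->
  is_derive y 1 (fun z => - ((x - z) `^ s / s)) ((x - y) `^ (s - 1)).
Proof.
move=> s0 yx.
have xy0 : 0 < x - y by rewrite subr_gt0.
have h1 : is_derive y 1 (fun z => x - z) (-1).
  have := is_deriveB (is_derive_cst x y 1) (is_derive_id y 1).
  by rewrite sub0r.
have h2 := @is_derive1_comp _ (fun w : R => w `^ s) (fun z =>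
  x - z) y _ _ (is_derive1_powR s xy0) h1.
have h3 : is_derive y 1 (fun z => (- s^-1) *: ((fun w : R => w `^ s) \o (fun z =>
  x - z)) z)
   ((x - y) `^ (s - 1)).
  apply: is_derive_eq.
  by rewrite /GRing.scale /=; field.
rewrite (_ : (fun z => _) = (fun z => (- s^-1) *: ((fun w : R => w `^ s) \o (fun z =>
  x - z)) z)) //.
by apply/funext => z /=; rewrite /GRing.scale /=; field.
Qed.

Lemma measurable_powR_sub x s (D : set R) : measurable_fun D (fun y => (x - y) `^ s).
Proof.
apply: (measurable_funS measurableT (@subsetT _ D)).
apply: (measurableT_comp (measurable_powR s)).
exact: measurable_funB.
Qed.

Lemma integral_powR_sub_cc c d x s : s != 0 -> c < d -> d < x ->
  (\int[mu]_(y in `[c, d]) ((x - y) `^ (s - 1))%:E =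
  ((x - c) `^ s / s - (x - d) `^ s / s)%:E)%E.
Proof.
move=> s0 cd dx.
have der y : y < x -> is_derive y 1 (fun z =>
  - ((x - z) `^ s / s)) ((x - y) `^ (s - 1)).
  exact: is_derive_powR_sub.
have cont (g : R -> R) (y l : R) : is_derive y 1 g l -> g z @[z --> y] --> g y.
  by move=> h; apply: differentiable_continuous; apply/derivable1_diffP;
    apply: ex_derive.
rewrite (@continuous_FTC2 _ _ (fun z => - ((x - z) `^ s / s)))//.
- by rewrite -EFinB opprK addrC.
- apply: continuous_in_subspaceT => y; rewrite inE/= in_itv/= => /andP[_ yd].
  have yx : y < x by exact: le_lt_trans dx.
  apply: (@continuous_comp _ _ _ (fun z => x - z) (fun w : R => w `^ (s - 1))).
    by apply: continuousB => //; exact: cst_continuous.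
  by apply: cont; apply: is_derive1_powR; rewrite subr_gt0.
- split.
  + move=> y; rewrite in_itv/= => /andP[_ yd]; have := der y (lt_trans yd dx).
    by move=> h; apply: ex_derive.
  + by apply: cvg_at_right_filter; apply: cont; apply: der; exact: lt_trans dx.
  + by apply: cvg_at_left_filter; apply: cont; apply: der.
- move=> y; rewrite in_itv/= => /andP[_ yd]; rewrite derive1E.
  by have h := der y (lt_trans yd dx); exact: derive_val.
Qed.

Lemma integral_powR_sub c x s : 0 < s -> c < x ->
  (\int[mu]_(y in `]c, x[) ((x - y) `^ (s - 1))%:E = ((x - c) `^ s / s)%:E)%E.
Proof.
move=> s0 cx.
(* The fundamental theorem of calculus is applied up to [d n], away from the singularity, and
   monotone convergence does the rest. The offset [n.+2] keeps [d n] strictly above [c] even for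
   [n = 0]. *)
pose d n := x - (x - c) / n.+2%:R.
have xc : 0 < x - c by rewrite subr_gt0.
have nd n : c < d n.
  rewrite /d ltrBrDr -ltrBrDl ltr_pdivrMr ?ltr0n//.
  by rewrite ltr_pMr// ltr1n.
have dx n : d n < x by rewrite /d ltrBlDr ltrDl divr_gt0.
rewrite integral_itv_obnd_cbnd; last first.
  by apply/measurable_EFinP; exact: measurable_powR_sub.
have -> : `[c, x[%classic = \bigcup_n `[c, d n]%classic.
  apply/seteqP; split => y /=; rewrite ?in_itv/=.
    move=> /andP[cy yx].
    have [n hn] : exists n : nat, (x - c) / (x - y) < n%:R.
      exists (Num.trunc ((x - c) / (x - y))).+1.
      exact: truncnS_gt.
    exists n => //=; rewrite in_itv/= cy/= /d.
    rewrite lerBrDr -lerBrDl ler_pdivrMr ?ltr0n// mulrC -ler_pdivrMr ?subr_gt0//.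
    by rewrite (le_trans (ltW hn))// ler_nat -addn2 leq_addr.
  move=> [n _] /=; rewrite !in_itv/= => /andP[-> yd]/=.
  exact: le_lt_trans (dx n).
have ndF : nondecreasing_seq (fun n => `[c, d n]%classic : set R).
  move=> m n mn; apply/subsetPset => y /=; rewrite !in_itv/= => /andP[-> yd]/=.
  rewrite (le_trans yd)// /d lerB// ler_pM2l// lef_pV2 ?posrE ?ltr0n//.
  by rewrite ler_nat !ltnS.
have cv := @ge0_nondecreasing_set_cvg_integral _ (measurableTypeR R) R _
  (fun y => ((x - y) `^ (s - 1))%:E) mu ndF.
rewrite -(cvg_lim _ (cv _ _ _))//; last 2 first.
- by move=> i; apply/measurable_EFinP; exact: measurable_powR_sub.
- by move=> i y _; rewrite lee_fin powR_ge0.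
apply: cvg_lim => //.
rewrite (_ : (fun n => _) = (fun n => ((x - c) `^ s / s - (x - d n) `^ s / s)%:E));
  last first.
  by apply/funext => n; rewrite integral_powR_sub_cc// gt_eqF.
apply: cvg_EFin; first by near=> n.
rewrite [in X in _ --> X](_ : (x - c) `^ s / s = (x - c) `^ s / s - 0 / s);
  last by rewrite mul0r subr0.
apply: cvgB; first exact: cvg_cst.
apply: cvgM; last exact: cvg_cst.
rewrite (_ : (fun n => _) = (fun n => (x - c) `^ s * (n.+2%:R^-1) `^ s)); last first.
  apply/funext => n; rewrite /d opprB addrC subrK powRM//; exact: ltW.
rewrite -[X in _ --> X](mulr0 ((x - c) `^ s)); apply: cvgMr.
apply: (@cvg_comp _ _ _ (fun n : nat => n.+2%:R^-1 : R) (fun w : R =>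
  w `^ s) _ (0^'+)); last exact: powR_cvg0.
have h0 : (fun n : nat => n.+2%:R^-1 : R) @ \oo --> (0 : R).
  by have := @cvg_harmonic R; rewrite -cvg_shiftS.
move=> A hA; apply: (@filterS nat \oo _ _ _ _ (h0 _ hA)) => n; apply.
by rewrite invr_gt0 ltr0n.
Unshelve. all: by end_near.
Qed.

Lemma integrable_powR_sub c x s : 0 < s -> c < x ->
  mu.-integrable `]c, x[ (EFin \o (fun y => (x - y) `^ (s - 1))).
Proof.
move=> s0 cx; apply/integrableP; split.
  by apply/measurable_EFinP; exact: measurable_powR_sub.
under eq_integral => y _ do rewrite /= ger0_norm ?powR_ge0//.
by rewrite integral_powR_sub// ltry.
Qed.

Lemma Rintegral_powR_sub c x s : 0 < s -> c < x ->
  \int[mu]_(y in `]c, x[) (x - y) `^ (s - 1) = (x - c) `^ s / s.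
Proof. by move=> s0 cx; rewrite /Rintegral integral_powR_sub. Qed.

Lemma integrable_le_powR_sub c x s M f : 0 < s -> c < x ->
  measurable_fun `]c, x[ f ->
  (forall y, c < y < x -> `|f y| <= M * (x - y) `^ (s - 1)) ->
  mu.-integrable `]c, x[ (EFin \o f).
Proof.
move=> s0 cx mf fM.
have := integrableZl _ M (integrable_powR_sub s0 cx); move=> /(_ _)/le_integrable.
apply => //; first exact/measurable_EFinP.
move=> y /=; rewrite in_itv/= => /fM fy; rewrite lee_fin.
by rewrite (le_trans fy)// ler_norm.
Qed.

Lemma le_Rintegral_powR_sub c x s M f : 0 < s -> c < x ->
  measurable_fun `]c, x[ f ->
  (forall y, c < y < x -> `|f y| <= M * (x - y) `^ (s - 1)) ->
  `|\int[mu]_(y in `]c, x[) f y| <= M * ((x - c) `^ s / s).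
Proof.
move=> s0 cx mf fM; have intf := integrable_le_powR_sub s0 cx mf fM.
rewrite (le_trans (le_normr_Rintegral _ intf))//.
rewrite -Rintegral_powR_sub// -RintegralZl//; last exact: integrable_powR_sub.
apply: le_Rintegral => //.
- exact: integrable_norm.
- by apply: (integrableZl _ M (integrable_powR_sub s0 cx)).
Qed.

Lemma Rintegral_itv_split a c b f : a < c -> c < b ->
  mu.-integrable `]a, b[ (EFin \o f) ->
  \int[mu]_(y in `]a, b[) f y =
  \int[mu]_(y in `]a, c[) f y + \int[mu]_(y in `]c, b[) f y.
Proof.
move=> ac cb intf.
have <- := @Rintegral_itvB R f (BRight a) (BLeft b) c intf (ltW _) _;
  rewrite ?bnd_simp//.
rewrite -Rintegral_itv_bndo_bndc ?subrKC//.
apply: integrableS intf => //; apply: subset_itvl; rewrite bnd_simp; exact: ltW.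
Qed.

End powR_integrals.

(** * Riemann–Liouville integrals at a steep point *)

Section RL_basics.
Context {R : realType}.
Local Notation mu := (@lebesgue_measure R).
Implicit Types (q a c k x z : R) (f g : R -> R).

(** The exponent is kept in the form [s - 1] with [s = 1 - q], to match the power integrals
    above. *)
Lemma invr_powR (x q : R) : (x `^ q)^-1 = x `^ ((1 - q) - 1).
Proof. by rewrite -powRN; congr (_ `^ _); ring. Qed.

Lemma integrable_RL_cst q k c x : q < 1 -> c < x ->
  mu.-integrable `]c, x[ (EFin \o RL_kernel q (cst k) x).
Proof.
move=> q1 cx.
have H : mu.-integrable `]c, x[ (EFin \o (fun y => (x - y) `^ ((1 - q) - 1))).
  by apply: integrable_powR_sub => //; rewrite subr_gt0.
apply: eq_integrable (integrableZl _ k H) => //.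
by move=> y _; rewrite /= /RL_kernel invr_powR EFinM.
Qed.

Lemma RL_integral_cst q k c x : q < 1 -> c < x ->
  RL_integral q (cst k) c x = k * ((x - c) `^ (1 - q) / (1 - q)).
Proof.
move=> q1 cx; rewrite /RL_integral /RL_kernel.
under eq_Rintegral => y _ do rewrite invr_powR.
rewrite RintegralZl// ?Rintegral_powR_sub ?subr_gt0//.
by apply: integrable_powR_sub => //; rewrite subr_gt0.
Qed.

Lemma integrable_RL_subcst q f k c x : q < 1 -> c < x ->
  mu.-integrable `]c, x[ (EFin \o RL_kernel q f x) ->
  mu.-integrable `]c, x[ (EFin \o RL_kernel q (fun y => f y - k) x).
Proof.
move=> q1 cx intf.
apply: eq_integrable (integrableB _ intf (integrable_RL_cst k q1 cx)) => //.
by move=> y _; rewrite /= /RL_kernel -EFinB mulrBl.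
Qed.

(** The integral of a constant is explicit, so [f] can be recentred at whichever value suits the
    estimate. *)
Lemma RL_integral_subcst q f k c x : q < 1 -> c < x ->
  mu.-integrable `]c, x[ (EFin \o RL_kernel q f x) ->
  RL_integral q f c x =
  RL_integral q (fun y => f y - k) c x + k * ((x - c) `^ (1 - q) / (1 - q)).
Proof.
move=> q1 cx intf; rewrite -RL_integral_cst// -RintegralD//.
- by apply: eq_Rintegral => y _; rewrite /= /RL_kernel -mulrDl subrK.
- exact: integrable_RL_subcst.
- exact: integrable_RL_cst.
Qed.

Lemma integrable_itv_cst k c x : c < x ->
  mu.-integrable `]c, x[ (EFin \o (fun=> k : R)).
Proof.
move=> cx; apply: eq_integrable (integrable_RL_cst k ltr01 cx) => //.
by move=> y _; rewrite /= /RL_kernel powRr0 divr1.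
Qed.

Lemma RL_kernelN q f x : RL_kernel q (\- f) x = \- RL_kernel q f x.
Proof. by apply/funext => y; rewrite /RL_kernel /= mulNr. Qed.

Lemma RL_derivableN q f a x : a < x -> RL_derivable q f a x ->
  RL_derivable q (\- f) a x.
Proof.
move=> ax [intf df]; split.
  apply: filterS intf => z /integrableN; apply: eq_integrable => //.
  by move=> y _; rewrite RL_kernelN.
apply: near_eq_derivable (derivableN df).
apply: filterS intf => z intf.
rewrite /RL_integral RL_kernelN /=.
have := @RintegralZl _ _ R mu `]a, z[ (RL_kernel q f z) (-1) _ intf.
under eq_Rintegral do rewrite mulN1r; move=> ->//.
by rewrite mulN1r.
Qed.

(* Subtracting g r from g makes g nonpositive on the left of r, where the kernel
   decreases from r to r + t, and nonnegative on its right. *)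
Lemma RL_integral_increment (alpha q : R) g (a r t m : R) :
  0 <= alpha -> 0 < q < 1 -> a < r -> 0 < t -> 0 < m ->
  (forall y, a < y < r -> g y <= g r) -> 0 <= g r ->
  (forall y, r < y < r + t -> m * (y - r) `^ alpha <= g y - g r) ->
  mu.-integrable `]a, r[ (EFin \o RL_kernel q g r) ->
  mu.-integrable `]a, (r + t)[ (EFin \o RL_kernel q g (r + t)) ->
  m * 2^-1 `^ alpha / 2 * t `^ alpha * t `^ (- q) * t <=
    RL_integral q g a (r + t) - RL_integral q g a r.
Proof.
have arith (A B C D E F X : R) : D <= A -> 0 <= B -> X <= C -> E <= F ->
    X <= (A + (B + C) + F) - (D + E) by lra.
move=> al0 /andP[q0 q1] ar t0 m0 gle gr0 phi_ge0 intr intt.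
set z := r + t in intt *.
have rz : r < z by rewrite ltrDl.
have az := lt_trans ar rz.
pose phi y := g y - g r.
rewrite (RL_integral_subcst (g r) q1 ar intr) (RL_integral_subcst (g r) q1 az intt).
rewrite -/phi.
have iz : mu.-integrable `]a, z[ (EFin \o RL_kernel q phi z).
  exact: integrable_RL_subcst.
have ir : mu.-integrable `]a, r[ (EFin \o RL_kernel q phi r).
  exact: integrable_RL_subcst.
have iS (u v : R) : a <= u -> v <= z ->
  mu.-integrable `]u, v[ (EFin \o RL_kernel q phi z).
  move=> au vz; apply: integrableS iz => //.
  by apply: subset_itvW.
have h1 : RL_integral q phi a r <= \int[mu]_(y in `]a, r[) RL_kernel q phi z y.
  apply: le_Rintegral => //; first by apply: iS => //; exact: ltW.
  move=> y /=; rewrite in_itv/= => /andP[ay yr]; rewrite /RL_kernel /phi.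
  apply: ler_wnM2l; first by rewrite subr_le0 gle ?ay.
  have yz := lt_trans yr rz.
  rewrite lef_pV2 ?posrE ?powR_gt0 ?subr_gt0//.
  by apply: ge0_ler_powR; rewrite ?nnegrE; lra.
(* On the first half of ]r, r + t[ the sign of [phi] suffices. The second half yields the lower
   bound: there [phi] is at least m (t/2)^alpha, the kernel is at least t^(-q), and the length is
   t/2. *)
have h2 : 0 <= \int[mu]_(y in `]r, (r + t / 2)[) RL_kernel q phi z y.
  apply: Rintegral_ge0 => y /=; rewrite in_itv/= => /andP[ry yt].
  rewrite /RL_kernel mulr_ge0 ?invr_ge0 ?powR_ge0//.
  apply: le_trans (phi_ge0 y _); first by rewrite mulr_ge0 ?powR_ge0// ltW.
  by rewrite ry (lt_trans yt)// /z ltrD2l; lra.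
have h3 : m * 2^-1 `^ alpha / 2 * t `^ alpha * t `^ (- q) * t <=
  \int[mu]_(y in `](r + t / 2), z[) RL_kernel q phi z y.
  have -> : m * 2^-1 `^ alpha / 2 * t `^ alpha * t `^ (- q) * t =
      \int[mu]_(y in `](r + t / 2), z[) (m * (t / 2) `^ alpha * t `^ (- q)).
    rewrite Rintegral_cst//= lebesgue_measure_itv/= lte_fin.
    rewrite ifT ?ltrD2l; last by lra.
    rewrite -EFinB /= (powRM _ (ltW t0)) ?invr_ge0//.
    by rewrite /z; field.
  apply: le_Rintegral => //.
  - by apply: integrable_itv_cst; rewrite /z ltrD2l; lra.
  - by apply: iS => //; rewrite (le_trans (ltW ar))// lerDl; lra.
  move=> y /=; rewrite in_itv/= => /andP[ry yz].
  rewrite /RL_kernel -powRN.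
  have t20 : 0 <= t / 2 by lra.
  apply: ler_pM; rewrite ?powR_ge0 ?mulr_ge0 ?powR_ge0//; first exact: ltW.
    apply: le_trans (phi_ge0 y _); last by rewrite yz andbT; lra.
    rewrite ler_pM2l//; apply: ge0_ler_powR; rewrite ?nnegrE//; lra.
  rewrite !powRN lef_pV2 ?posrE ?powR_gt0//; last by rewrite subr_gt0.
  apply: ge0_ler_powR; rewrite ?nnegrE/= ?(ltW q0) ?(ltW t0)//; first by lra.
  by rewrite /z; lra.
have h4 : g r * ((r - a) `^ (1 - q) / (1 - q)) <= g r * ((z - a) `^ (1 - q) / (1 - q)).
  apply: ler_wpM2l => //; rewrite ler_pM2r ?invr_gt0 ?subr_gt0//.
  by apply: ge0_ler_powR; rewrite ?nnegrE; lra.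
have h5 : RL_integral q phi a z = \int[mu]_(y in `]a, r[) RL_kernel q phi z y +
   (\int[mu]_(y in `]r, (r + t / 2)[) RL_kernel q phi z y +
    \int[mu]_(y in `](r + t / 2), z[) RL_kernel q phi z y).
  rewrite /RL_integral (Rintegral_itv_split ar rz)// (@Rintegral_itv_split _ r (r +
    t / 2))//.
  - by rewrite ltrDl; lra.
  - by rewrite ltrD2l; lra.
  - by apply: iS => //; exact: ltW.
by rewrite h5; exact: arith.
Qed.

End RL_basics.

Section RL_neg.
Context {R : realType}.
Local Notation mu := (@lebesgue_measure R).
(** By [RL_integral_increment], the right difference quotients at [r] are at least a positive
    multiple of t^(alpha - q), which blows up as t tends to 0. *)
Lemma not_RL_derivable_steep (alpha q : R) g (a r e m : R) :
  alpha < q -> 0 < q < 1 -> a < r -> 0 < e -> 0 < m -> 0 <= alpha ->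
  (forall y, a < y < r -> g y <= g r) -> 0 <= g r ->
  (forall t : R, 0 < t < e -> m * t `^ alpha <= g (r + t) - g r) ->
  ~ RL_derivable q g a r.
Proof.
have arith (X k n : R) : -1 < k - X -> k <= n -> X <= n + 1 by lra.
move=> aq /andP[q0 q1] ar e0 m0 al0 gle gr0 gsteep [intg].
pose c := m * 2^-1 `^ alpha / 2.
have c0 : 0 < c by rewrite divr_gt0// mulr_gt0// powR_gt0.
have intr : mu.-integrable `]a, r[ (EFin \o RL_kernel q g r).
  exact: (nbhs_singleton intg).
move=> dJ.
have : (fun t : R => t^-1 * (RL_integral q g a (t +
  r) - RL_integral q g a r)) @ 0^'+ -->
    @derive R R R (RL_integral q g a) r 1.
  apply: cvg_dnbhs_at_right; apply: cvg_trans dJ.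
  apply: near_eq_cvg; near=> t; by rewrite /GRing.scale/= mulr1.
set l := @derive _ _ _ _ _ _ => /cvgrPdist_lt/(_ 1 ltr01) hl.
(* Once t^(q - alpha) is below this threshold, c t^(alpha - q) exceeds |l| + 1, while a quotient
   within 1 of the limit [l] is at most |l| + 1. *)
have M0 : 0 < c / (`|l| + 1) by rewrite divr_gt0// ltr_wpDl.
have : \forall t \near 0^'+, t `^ (q - alpha) < c / (`|l| + 1).
  have qa : 0 < q - alpha by rewrite subr_gt0.
  have /cvgrPdist_lt/(_ _ M0) := powR_cvg0 qa.
  by apply: filterS => t; rewrite sub0r normrN ger0_norm// powR_ge0.
move=> hM.
have intn : \forall t \near 0^'+, mu.-integrable `]a, (r +
  t)[ (EFin \o RL_kernel q g (r + t)).
  have : (fun t => r + t) @ (0:R)^'+ --> r.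
    apply: cvg_at_right_filter; rewrite -[X in _ --> X]addr0.
    by apply: cvgD; [exact: cvg_cst|exact: cvg_id].
  by move=> /(_ _ intg).
have : \forall t \near (0:R)^'+, False.
  near=> t.
  have t0 : 0 < t by near: t; exact: nbhs_right_gt.
  have te : t < e by near: t; exact: nbhs_right_lt.
  have h1 : `|l - t^-1 * (RL_integral q g a (t + r) - RL_integral q g a r)| < 1.
    by near: t.
  have h2 : t `^ (q - alpha) < c / (`|l| + 1) by near: t.
  have h3 : mu.-integrable `]a, (r + t)[ (EFin \o RL_kernel q g (r + t)) by near: t.
  have h4 : c * t `^ alpha * t `^ (- q) * t <=
    RL_integral q g a (r + t) - RL_integral q g a r.
    apply: RL_integral_increment => //; first by rewrite q0.
    move=> y /andP[ry yt]; have := gsteep (y - r); rewrite subrKC; apply.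
    by rewrite subr_gt0 ry/= (lt_trans _ te)// ltrBlDl.
  have : c * t `^ alpha * t `^ (- q) <= `|l| + 1.
    have {}h4 : c * t `^ alpha * t `^ (- q) <=
      t^-1 * (RL_integral q g a (t + r) - RL_integral q g a r).
      by rewrite (ler_pdivlMl _ _ t0) mulrC (addrC t r); exact: h4.
    apply: (le_trans h4); move: h1; set X := t^-1 * _; rewrite ltr_norml => /andP[h1 _].
    by apply: arith h1 _; exact: ler_norm.
  rewrite leNgt => /negP; apply.
  rewrite -mulrA -powRD ?(gt_eqF t0) ?implybT// -(opprB q alpha).
  by rewrite powRN ltr_pdivlMr ?powR_gt0// mulrC -ltr_pdivlMr// ltr_wpDl.
by move/filter_ex => -[].
Unshelve. all: by end_near.
Qed.

End RL_neg.

(** * Hölder functions *)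

Section RL_pos.
Context {R : realType}.
Local Notation mu := (@lebesgue_measure R).

(** The dominating power is nonnegative, so its integral can be extended from [d] to [x]; the
    resulting bound does not depend on [d]. *)
Lemma le_Rintegral_powR_sub_lt (c d x s M : R) (f : R -> R) :
  0 < s -> c < d -> d < x -> 0 <= M ->
  mu.-integrable `]c, d[ (EFin \o f) ->
  (forall y, c < y < d -> `|f y| <= M * (x - y) `^ (s - 1)) ->
  `|\int[mu]_(y in `]c, d[) f y| <= M * ((x - c) `^ s / s).
Proof.
move=> s0 cd dx M0 intf fM; have cx := lt_trans cd dx.
have intp := integrable_powR_sub s0 cx.
have intpd : mu.-integrable `]c, d[ (EFin \o (fun y => (x - y) `^ (s - 1))).
  by apply: integrableS intp => //; apply: subset_itvl; rewrite bnd_simp ltW.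
rewrite (le_trans (le_normr_Rintegral _ intf))//.
rewrite -Rintegral_powR_sub// (Rintegral_itv_split cd dx intp).
apply: (@le_trans _ _ (M * \int[mu]_(y in `]c, d[) (x - y) `^ (s - 1))).
  rewrite -RintegralZl//; apply: le_Rintegral => //.
  - exact: integrable_norm.
  - by apply: (integrableZl _ M intpd).
apply: ler_wpM2l => //; rewrite lerDl; apply: Rintegral_ge0 => y _.
exact: powR_ge0.
Qed.

(** A Bernoulli inequality: the power is exp(- q ln(1 + t)), and both exp u >= 1 + u and ln(1 + t)
    <= t apply. *)
Lemma powRN_ge_linear (q t : R) : 0 <= q -> -1 < t -> 1 - q * t <= (1 + t) `^ (- q).
Proof.
move=> q0 t1; have t0 : 0 < 1 + t by lra.
rewrite /powR gt_eqF//; apply: le_trans (expR_ge1Dx _).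
rewrite mulNr lerD2l lerN2 ler_wpM2l//.
by have := le_ln1Dx t1.
Qed.

(* The upper bound comes from [powRN_ge_linear] for the exponent 1 - q, since
   (1 + t) ^ - q is the inverse of (1 + t) * (1 + t) ^ - (1 - q). *)
Lemma powRN_quadratic_remainder1 (q t : R) : 0 <= q <= 1 -> `|t| <= 2^-1 ->
  `|(1 + t) `^ (- q) - 1 + q * t| <= 4 * t ^+ 2.
Proof.
move=> /andP[q0 q1]; rewrite ler_norml => /andP[t0 t1].
have tp : 0 < 1 + t by lra.
have lo : 1 - q * t <= (1 + t) `^ (- q) by apply: powRN_ge_linear; lra.
rewrite ger0_norm; last by lra.
have hi : 1 - (1 - q) * t <= (1 + t) `^ (- (1 - q)) by apply: powRN_ge_linear; lra.
have e1 : (1 + t) `^ (- q) * ((1 + t) * (1 + t) `^ (- (1 - q))) = 1.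
  rewrite -{2}(powRr1 (ltW tp)) -!powRD ?(gt_eqF tp) ?implybT//.
  by rewrite (_ : - q + _ = 0) ?powRr0//; ring.
move: lo hi e1; set A := _ `^ (- q); set B := _ `^ (- (1 - q)).
move=> lo hi e1.
have A0 : 0 < A by exact: powR_gt0.
have h1 : A * ((1 + t) * (1 - (1 - q) * t)) <= 1.
  by rewrite -[leRHS]e1 ler_pM2l// ler_pM2l.
have t20 : 0 <= t * t by rewrite -expr2 sqr_ge0.
clear - h1 q0 q1 t0 t1 A0 t20.
have t2 : 0 <= (2^-1 - t) * (2^-1 + t) by apply: mulr_ge0; lra.
have hd : 2^-1 <= (1 + t) * (1 - (1 - q) * t).
  have : 0 <= q * (2^-1 + t) by apply: mulr_ge0; lra.
  have : 0 <= (1 - q) * (2^-1 - t * t) by apply: mulr_ge0; lra.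
  lra.
have hk : q * q + (1 - q) * (1 - q * t) <= 2.
  have : 0 <= (1 - q) * q * (2^-1 + t) by rewrite !mulr_ge0//; lra.
  have : 0 <= q * (1 - q) by apply: mulr_ge0; lra.
  lra.
(* Put K = q^2 + (1 - q)(1 - q t), so that (1 - q t) D = 1 - K t^2. From A D <= 1, K <= 2 and D >=
   1/2 follows (A - 1 + q t) D <= 2 t^2 <= 4 t^2 D. *)
set D := (1 + t) * (1 - (1 - q) * t) in h1 hd.
rewrite -(@ler_pM2r _ D); last by lra.
have : 0 <= t * t * (D - 2^-1) by apply: mulr_ge0 => //; lra.
have : 0 <= t * t * (2 - (q * q + (1 - q) * (1 - q * t))) by apply: mulr_ge0 => //; lra.
have -> : (A - 1 + q * t) * D = A * D - (1 - (q * q + (1 - q) * (1 - q * t)) * (t * t)).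
  by rewrite /D; ring.
move: h1; rewrite expr2; generalize (A * D) => AD; lra.
Qed.

(** By homogeneity this is the case w = 1 applied to t / w. *)
Lemma powRN_quadratic_remainder (q w t : R) : 0 <= q <= 1 -> 0 < w -> `|t| <= w / 2 ->
  `|(w + t) `^ (- q) - w `^ (- q) + q * t * w `^ (- q - 1)| <=
  4 * t ^+ 2 * w `^ (- q - 2).
Proof.
move=> q01 w0 tw.
have w1 : `|t / w| <= 2^-1.
  by rewrite normrM normfV (gtr0_norm w0) ler_pdivrMr// mulrC.
have h := powRN_quadratic_remainder1 q01 w1.
have wq k : w `^ (- q - k%:R) = w `^ (- q) / w ^+ k.
  by rewrite powRD ?(gt_eqF w0) ?implybT// powR_invn// ltW.
rewrite (wq 1%N) (wq 2%N) expr1.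
have -> : (w + t) `^ (- q) = w `^ (- q) * (1 + t / w) `^ (- q).
  rewrite -powRM ?(ltW w0)//; first by congr (_ `^ _); field; rewrite gt_eqF.
  by move: w1; rewrite ler_norml => /andP[]; lra.
set X := w `^ (- q); have X0 : 0 < X by exact: powR_gt0.
rewrite [Y in `|Y|](_ : _ = X * ((1 + t / w) `^ (- q) - 1 + q * (t / w))); last first.
  by field; rewrite gt_eqF.
rewrite normrM gtr0_norm// [leRHS](_ : _ = X * (4 * (t / w) ^+ 2)); last first.
  by field; rewrite gt_eqF.
by rewrite ler_pM2l.
Qed.

(** The modulus [e] is evaluated at |t| only, hence its one-sided limit; this fits moduli built from
    powers. *)
Lemma is_derive_of_remainder (F : R -> R) (x L : R) (e : R -> R) :
  e t @[t --> 0^'+] --> 0 ->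
  (\forall t \near (0:R)^', `|F (x + t) - F x - t * L| <= `|t| * e `|t|) ->
  is_derive x 1 F L.
Proof.
move=> e0 hF.
have cv : h^-1 *: (F (h *: 1 + x) - F x) @[h --> 0^'] --> L.
  apply/cvgrPdist_le => d d0.
  have h1 : \forall t \near (0:R)^', e `|t| <= d.
    have /cvgrPdist_le/(_ _ d0) := e0.
    rewrite /at_right near_withinE => h.
    have hn : `|t| @[t --> (0 : R)] --> (0 : R).
      by rewrite -[X in _ --> X](@normr0 _ R); exact: norm_continuous.
    suff : nbhs (0 : R) (fun t => t != 0 -> e `|t| <= d) by exact.
    apply: (@filterS _ (nbhs (0 : R)) _ _ _ _ (hn _ h)) => t /= ht t0.
    have := ht _; rewrite normr_gt0 => /(_ t0).
    by rewrite sub0r normrN; apply: le_trans; exact: ler_norm.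
  near=> t.
  have t0 : t != 0 by near: t; exact: nbhs_dnbhs_neq.
  have h2 : `|F (x + t) - F x - t * L| <= `|t| * e `|t| by near: t.
  have h3 : e `|t| <= d by near: t.
  rewrite /GRing.scale/= mulr1 (addrC t).
  rewrite (_ : L - _ = - (t^-1 * (F (x + t) - F x - t * L))); last by field.
  rewrite normrN normrM normfV mulrC ler_pdivrMr ?normr_gt0//.
  by apply: (le_trans h2); rewrite mulrC ler_pM2r// normr_gt0.
by split; [apply/cvg_ex; exists L|exact: cvg_lim cv].
Unshelve. all: by end_near.
Qed.

End RL_pos.

(** * Marchaud's formula for Hölder functions *)

Section holder.
Context {R : realType}.
Local Notation mu := (@lebesgue_measure R).

Lemma holder_cvg (C alpha x : R) (f : R -> R) : 0 < alpha -> 0 <= C ->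
  (\forall y \near x, `|f x - f y| <= C * `|x - y| `^ alpha) ->
  f y @[y --> x] --> f x.
Proof.
move=> al0 C0 fC; apply/cvgrPdist_lt => e e0.
(* The denominator [C + 1] stays positive when [C] is 0 and makes the final inequality strict. *)
pose d := (e / (C + 1)) `^ alpha^-1.
have eC : 0 < e / (C + 1) by rewrite divr_gt0// ltr_wpDl.
have d0 : 0 < d by exact: powR_gt0.
near=> y.
have yd : `|x - y| < d by near: y; exact: cvgr_dist_lt.
have h1 : `|f x - f y| <= C * `|x - y| `^ alpha by near: y.
apply: (le_lt_trans h1).
have h2 : `|x - y| `^ alpha <= e / (C + 1).
  have <- : d `^ alpha = e / (C + 1).
    by rewrite /d -powRrM mulVf ?gt_eqF// powRr1// ltW.
  by apply: ge0_ler_powR; rewrite ?nnegrE ?(ltW al0) ?(ltW d0) ?(ltW yd).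
apply: (le_lt_trans (ler_wpM2l C0 h2)).
by rewrite mulrA ltr_pdivrMr ?ltr_wpDl// mulrC ltr_pM2l// ltrDl.
Unshelve. all: by end_near.
Qed.

Context (alpha q C a b : R) (h : R -> R).
Context (q0 : 0 < q) (qa : q < alpha) (al1 : alpha < 1) (C0 : 0 <= C).
Context (hC : forall x y, a <= x < b -> a <= y < b ->
  `|h x - h y| <= C * `|x - y| `^ alpha).

Let q1 : q < 1. Proof. exact: lt_trans al1. Qed.
Let al0 : 0 < alpha. Proof. exact: lt_trans qa. Qed.

Lemma holder_measurable z : z <= b -> measurable_fun `]a, z[ h.
Proof.
move=> zb; apply: open_continuous_measurable_fun => //.
move=> y; rewrite inE/= in_itv/= => /andP[ay yz].
apply: (@holder_cvg C alpha) => //; near=> t.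
apply: hC; first by rewrite ltW//= (lt_le_trans yz).
apply/andP; split; first by rewrite ltW//; near: t; exact: lt_nbhsr.
by near: t; apply: lt_nbhsl; exact: lt_le_trans zb.
Unshelve. all: by end_near.
Qed.

Lemma measurable_holder_kernel k p u c z : a <= c -> u <= b ->
  measurable_fun `]c, u[ (fun y => (h y - k) * (z - y) `^ p).
Proof.
move=> ac ub; apply: measurable_funM; last exact: measurable_powR_sub.
apply: measurable_funB => //; apply: measurable_funS (holder_measurable ub) => //.
by apply: subset_itvr; rewrite bnd_simp.
Qed.

(** The singularity sits at [z] while the increment vanishes at [x], so the increment is merely
    bounded by a constant and q < 1 gives integrability. *)
Lemma integrable_holder_kernel x z : a <= x < b -> a < z <= b ->
  mu.-integrable `]a, z[ (EFin \o (fun y => (h y - h x) * (z - y) `^ (- q))).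
Proof.
move=> /andP[ax xb] /andP[az zb].
have q1' : 0 < 1 - q by rewrite subr_gt0.
have ab := le_lt_trans ax xb.
apply: (@integrable_le_powR_sub _ _ _ (1 - q) (C * (b - a) `^ alpha)) => //.
  exact: measurable_holder_kernel.
move=> y /andP[ay yz]; rewrite (_ : 1 - q - 1 = - q); last by ring.
rewrite normrM [X in _ * X]ger0_norm ?powR_ge0// ler_wpM2r ?powR_ge0//.
have yb := lt_le_trans yz zb.
apply: (le_trans (hC _ _)); rewrite ?(ltW ay) ?ax//.
rewrite ler_wpM2l//; apply: ge0_ler_powR; rewrite ?nnegrE ?(ltW al0)// ?subr_ge0 ?ltW//.
by rewrite ltr_norml; apply/andP; split; lra.
Qed.

(** The exponent - q - 1 alone is not integrable at [x]; the Hölder increment raises it to alpha - q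
    - 1 > -1. *)
Lemma marchaud_kernel_le x y : a < x < b -> a < y < x ->
  `|(h y - h x) * (x - y) `^ (- q - 1)| <= C * (x - y) `^ (alpha - q - 1).
Proof.
move=> /andP[ax xb] /andP[ay yx].
have xy0 : 0 < x - y by rewrite subr_gt0.
rewrite normrM [X in _ * X]ger0_norm ?powR_ge0//.
rewrite (_ : alpha - q - 1 = alpha + (- q - 1)); last by ring.
rewrite powRD ?(gt_eqF xy0) ?implybT// mulrA ler_wpM2r ?powR_ge0//.
apply: (le_trans (hC _ _)); rewrite ?(ltW ay) ?(ltW ax) ?(lt_trans yx)//=.
by rewrite distrC gtr0_norm.
Qed.

Lemma integrable_marchaud_kernel x : a < x < b ->
  mu.-integrable `]a, x[ (EFin \o (fun y => (h y - h x) * (x - y) `^ (- q - 1))).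
Proof.
move=> /andP[ax xb]; have eta0 : 0 < alpha - q by rewrite subr_gt0.
apply: (@integrable_le_powR_sub _ _ _ (alpha - q) C) => //.
  by apply: measurable_holder_kernel => //; exact: ltW.
by move=> y ayx; apply: marchaud_kernel_le; rewrite ?ax.
Qed.

(* [marchaud x] is the derivative at z = x of [centered_RL_integral x z]. *)
Definition marchaud x := - q * \int[mu]_(y in `]a, x[) ((h y - h x) * (x - y) `^ (- q
  - 1)).

(** Subtracting [h x], with [x] fixed while [z] moves, makes the numerator vanish where the
    differentiated kernel is singular at z = x. *)
Definition centered_RL_integral x z :=
  \int[mu]_(y in `]a, z[) ((h y - h x) * (z - y) `^ (- q)).

Lemma norm_marchaud_le x : a < x < b ->
  `|marchaud x| <= q * (C * ((x - a) `^ (alpha - q) / (alpha - q))).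
Proof.
move=> /andP[ax xb]; have eta0 : 0 < alpha - q by rewrite subr_gt0.
rewrite /marchaud normrM normrN (gtr0_norm q0) ler_pM2l//.
apply: le_Rintegral_powR_sub => //.
  by apply: measurable_holder_kernel => //; exact: ltW.
by move=> y ayx; apply: marchaud_kernel_le; rewrite ?ax.
Qed.

(* The integrals are split at x - 2 |t|: on the left the kernel is expanded to second
   order in t, on the right every term is bounded separately. *)
Lemma holder_remainder (x t : R) : a < x < b -> t != 0 -> `|t| + `|t| < x - a ->
  x + t < b ->
  `|centered_RL_integral x (x + t) - centered_RL_integral x x - t * marchaud x| <=
  `|t| * ((6 * C / (1 - q) + C / (alpha - q)) * (3 * `|t|) `^ (alpha - q) +
          4 * C * ((x - a) `^ ((alpha - q) / 2) / ((alpha - q) / 2)) * `|t| `^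
            ((alpha - q) / 2)).
Proof.
have hal2 : alpha - q < 2 by have := q0; have := al1; lra.
have arith (Az Ax AD Bz Bx BD Q E1 E2 E3 : R) :
    `|Az - Ax + Q * AD| <= E1 -> `|Bz| <= E2 -> `|Bx| <= E2 -> `|Q * BD| <= E3 ->
  `|(Az + Bz) - (Ax + Bx) + Q * (AD + BD)| <= E2 + E2 + E3 + E1.
  move=> h1 h2 h3 h4.
  rewrite (_ : _ + _ = Bz + - Bx + Q * BD + (Az - Ax + Q * AD)); last by ring.
  apply: (le_trans (ler_normD _ _)); apply: lerD => //.
  apply: (le_trans (ler_normD _ _)); apply: lerD => //.
  by apply: (le_trans (ler_normD _ _)); apply: lerD => //; rewrite normrN.
have arith3 (A B D n u v : R) : u != 0 -> v != 0 ->
    n * (3 * C / u * A) + n * (3 * C / u * A) + n * (C * (A / v)) +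
      4 * C * n * D * (B / (v / 2)) =
    n * ((6 * C / u + C / v) * A + 4 * C * (B / (v / 2)) * D).
  by move=> u0 v0; field; rewrite u0 v0.
have arith4 (c n u y w : R) : 0 < n -> c + (n + n) = w -> u - c <= 3 * n -> c < y ->
  y < u -> `|y - w| <= 3 * n.
  by move=> *; rewrite ler_norml; apply/andP; split; lra.
have arith2 (c u s : R) : c + (`|s| + `|s|) = u -> s != 0 ->
  c < u + s /\ u + s - c <= 3 * `|s|.
  by rewrite -normr_gt0; case: (ger0P s) => _ ? ?; split; lra.
move=> /andP[ax xb] t0 txa xtb.
set n : R := `|t|; have n0 : 0 < n by rewrite normr_gt0.
(* For y < c the distance w = x - y is at least 2 |t|, as [powRN_quadratic_remainder] requires, and
   [c] stays to the left of both [x] and [x + t] whatever the sign of [t]. *)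
pose c := x - (n + n); pose z := x + t.
have ac : a < c by rewrite /c ltrBrDl -ltrBrDr.
have cx : c < x by rewrite /c ltrBlDr ltrDl addr_gt0.
have [cz zc] : c < z /\ z - c <= 3 * n by apply: arith2 t0; rewrite /c subrK.
have az := lt_trans ac cz.
have eta0 : 0 < alpha - q by rewrite subr_gt0.
have q1' : 0 < 1 - q by rewrite subr_gt0.
have xc : x - c <= 3 * n by rewrite /c opprB addrC subrK; lra.
have iz : mu.-integrable `]a, z[ (EFin \o (fun y => (h y - h x) * (z - y) `^ (- q))).
  by apply: integrable_holder_kernel; rewrite ?(ltW ax) ?az ?(ltW xtb).
have ix : mu.-integrable `]a, x[ (EFin \o (fun y => (h y - h x) * (x - y) `^ (- q))).
  by apply: integrable_holder_kernel; rewrite ?ax ?(ltW ax) ?(ltW xb).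
have iD : mu.-integrable `]a, x[ (EFin \o (fun y =>
  (h y - h x) * (x - y) `^ (- q - 1))).
  by apply: integrable_marchaud_kernel; rewrite ax.
pose fz y := (h y - h x) * (z - y) `^ (- q).
pose fx y := (h y - h x) * (x - y) `^ (- q).
pose fD y := (h y - h x) * (x - y) `^ (- q - 1).
have izc : mu.-integrable `]a, c[ (EFin \o fz).
  by apply: integrableS iz => //; apply: subset_itvl; rewrite bnd_simp ltW.
have ixc : mu.-integrable `]a, c[ (EFin \o fx).
  by apply: integrableS ix => //; apply: subset_itvl; rewrite bnd_simp ltW.
have iDc : mu.-integrable `]a, c[ (EFin \o fD).
  by apply: integrableS iD => //; apply: subset_itvl; rewrite bnd_simp ltW.
have iZc : mu.-integrable `]a, c[ (EFin \o (fun y => q * t * fD y)).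
  exact: (integrableZl _ (q * t) iDc).
have iBc : mu.-integrable `]a, c[ (EFin \o (fun y => fz y - fx y)).
  exact: (integrableB _ izc ixc).
have iSc : mu.-integrable `]a, c[ (EFin \o (fun y => fz y - fx y + q * t * fD y)).
  exact: (integrableD _ iBc iZc).
have hA : `|\int[mu]_(y in `]a, c[) fz y - \int[mu]_(y in `]a, c[) fx y +
  q * t * \int[mu]_(y in `]a, c[) fD y| <=
    4 * C * n * n `^ ((alpha - q) / 2) * ((x - a) `^ ((alpha - q) / 2) / ((alpha - q)
      / 2)).
  rewrite -RintegralB// -RintegralZl// -RintegralD//.
  apply: (@le_Rintegral_powR_sub_lt _ a c x _ _ _) => //.
  - by rewrite divr_gt0.
  - by rewrite !mulr_ge0 ?powR_ge0// ltW.
  move=> y /andP[ay yc]; rewrite /fz /fx /fD.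
  have yx := lt_trans yc cx.
  pose w := x - y; have w0 : 0 < w by rewrite subr_gt0.
  have nw : n + n <= w by rewrite /w lerBrDr -lerBrDl ltW.
  have -> : z - y = w + t by rewrite /z /w; ring.
  rewrite -/w (_ : _ + _ = (h y - h x) * ((w + t) `^ (- q) - w `^ (- q) +
    q * t * w `^ (- q - 1))); last by ring.
  have h1 : `|h y - h x| <= C * w `^ alpha.
    apply: (le_trans (hC _ _)); rewrite ?(ltW ay) ?(ltW ax) ?(lt_trans yx)//=.
    by rewrite distrC gtr0_norm.
  have h2 : `|(w + t) `^ (- q) - w `^ (- q) + q * t * w `^ (- q - 1)| <=
    4 * t ^+ 2 * w `^ (- q - 2).
    apply: powRN_quadratic_remainder => //; first by rewrite !ltW.
    by rewrite ler_pdivlMr// mulr_natr mulr2n.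
  rewrite normrM; apply: (le_trans (ler_pM _ _ h1 h2)) => //.
  (* Let eta = alpha - q. Of n^2 = n n^(eta/2) n^(1 - eta/2), the last factor is replaced by w^(1 -
     eta/2), since n <= w. The power of w becomes eta/2 - 1, which is integrable, and n^(eta/2)
     remains as a factor tending to 0. *)
  have -> : t ^+ 2 = n * (n `^ ((alpha - q) / 2) * n `^ (1 - (alpha - q) / 2)).
    rewrite -powRD ?(gt_eqF n0) ?implybT// subrKC powRr1 ?(ltW n0)//.
    by rewrite /n -expr2 real_normK ?num_real.
  have h3 : n `^ (1 - (alpha - q) / 2) <= w `^ (1 - (alpha - q) / 2).
    apply: ge0_ler_powR; rewrite ?nnegrE ?(ltW n0) ?(ltW w0)//; last first.
      by rewrite (le_trans _ nw)// lerDl ltW.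
    by rewrite subr_ge0 ler_pdivrMr // mul1r ltW.
  have -> : w `^ ((alpha - q) / 2 - 1) =
    w `^ alpha * w `^ (1 - (alpha - q) / 2) * w `^ (- q - 2).
    rewrite -!powRD ?(gt_eqF w0) ?implybT//; congr (_ `^ _); by field.
  move: h3; generalize (n `^ (1 - (alpha - q) / 2)) (w `^ (1 - (alpha - q) / 2)) =>
    A B AB.
  rewrite [leLHS](_ : _ = 4 * C * n * n `^ ((alpha - q) / 2) * (w `^ alpha * A * w `^
    (- q - 2))); last by ring.
  apply: ler_wpM2l; first by rewrite !mulr_ge0 ?powR_ge0// ltW.
  by apply: ler_wpM2r; rewrite ?powR_ge0//; apply: ler_wpM2l; rewrite ?powR_ge0.
have ce : c + (n + n) = x by rewrite /c subrK.
have hq : - q = 1 - q - 1 by ring.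
have cb : c < b by exact: lt_trans xb.
have phi_le y : c < y -> y < b -> `|y - x| <= 3 * n ->
  `|h y - h x| <= C * (3 * n) `^ alpha.
  move=> cy yb yx; apply: (le_trans (hC _ _));
    rewrite ?(ltW ax) ?xb ?yb ?(ltW (lt_trans ac cy))//.
  by rewrite ler_wpM2l// ge0_ler_powR ?nnegrE ?(ltW al0) ?mulr_ge0 ?(ltW n0)// distrC.
(* Used for both u = z and u = x. The point [c] is 2n to the left of [x] and [u] is at most n to its
   right, whence the constant 3. *)
have hB (u : R) : c < u -> u < b -> u - c <= 3 * n -> 
    `|\int[mu]_(y in `]c, u[) ((h y - h x) * (u - y) `^ (- q))| <=
    C * (3 * n) `^ alpha * ((3 * n) `^ (1 - q) / (1 - q)).
  move=> cu ub uc.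
  apply: (@le_trans _ _ (C * (3 * n) `^ alpha * ((u - c) `^ (1 - q) / (1 - q)))).
    apply: le_Rintegral_powR_sub => //.
      by apply: measurable_holder_kernel; exact: ltW.
    move=> y /andP[cy yu]; rewrite -hq normrM [X in _ * X]ger0_norm ?powR_ge0//
      ler_wpM2r ?powR_ge0//.
    apply: phi_le => //; first exact: lt_trans ub.
    exact: arith4 n0 ce uc cy yu.
  apply: ler_wpM2l; first by rewrite mulr_ge0 ?powR_ge0.
  apply: ler_wpM2r; first by rewrite invr_ge0 ltW.
  by apply: ge0_ler_powR; rewrite ?nnegrE ?mulr_ge0 ?(ltW eta0) ?(ltW q1') ?(ltW
    n0)// subr_ge0 ltW.
have hBD : `|q * t * \int[mu]_(y in `]c, x[) fD y| <=
  n * (C * ((3 * n) `^ (alpha - q) / (alpha - q))).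
  rewrite normrM; apply: ler_pM => //.
    by rewrite normrM (gtr0_norm q0) ger_pMl// ltW.
  apply: (@le_trans _ _ (C * ((x - c) `^ (alpha - q) / (alpha - q)))).
    apply: le_Rintegral_powR_sub => //.
      by apply: measurable_holder_kernel; exact: ltW.
    by move=> y /andP[cy yx]; apply: marchaud_kernel_le; rewrite ?ax// yx (lt_trans ac).
  apply: ler_wpM2l => //; apply: ler_wpM2r; first by rewrite invr_ge0 ltW.
  by apply: ge0_ler_powR; rewrite ?nnegrE ?mulr_ge0 ?(ltW eta0) ?(ltW q1') ?(ltW
    n0)// subr_ge0 ltW.
rewrite /centered_RL_integral -/z /marchaud (Rintegral_itv_split ac cz iz)
  (Rintegral_itv_split ac cx ix) (Rintegral_itv_split ac cx iD).
have E (X Y : R) : X - t * (- q * Y) = X + q * t * Y by ring.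
rewrite E; apply: le_trans (arith _ _ _ _ _ _ _ _ _ _ hA (hB z cz xtb zc) (hB x cx xb
  xc) hBD) _.
have -> : C * (3 * n) `^ alpha * ((3 * n) `^ (1 - q) / (1 - q)) =
  n * (3 * C / (1 - q) * (3 * n) `^ (alpha - q)).
  have n30 : 0 < 3 * n by rewrite mulr_gt0.
  have -> : (3 * n) `^ (1 - q) = 3 * n * (3 * n) `^ (- q).
    by rewrite -{2}(powRr1 (ltW n30)) -powRD ?(gt_eqF n30) ?implybT.
  rewrite powRD ?(gt_eqF n30) ?implybT//.
  by field; rewrite gt_eqF.
rewrite le_eqVlt; apply/orP; left; apply/eqP.
by apply: arith3; rewrite gt_eqF.
Qed.

End holder.

Section holder_frac.
Context {R : realType}.
Local Notation mu := (@lebesgue_measure R).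

Lemma cvg_sub_at_right (a : R) : x - a @[x --> a^'+] --> 0^'+.
Proof.
move=> A hA.
have : x - a @[x --> a] --> (0 : R).
  by rewrite -(subrr a); apply: cvgB; [exact: cvg_id|exact: cvg_cst].
move=> /(_ _ hA) => h.
apply: (@filterS _ (nbhs a) _ _ _ _ h) => x /= hx ax.
by apply: hx; rewrite subr_gt0.
Qed.

Lemma is_derive_powR_shift (a k q x : R) : q < 1 -> a < x ->
  is_derive x 1 (fun z => k * ((z - a) `^ (1 - q) / (1 - q))) (k * (x - a) `^ (- q)).
Proof.
move=> q1 ax.
have q10 : 1 - q != 0 by rewrite subr_eq0 gt_eqF.
have xa0 : 0 < x - a by rewrite subr_gt0.
have h1 : is_derive x 1 (fun z => z - a) 1.
  have := is_deriveB (is_derive_id x 1) (is_derive_cst a x 1).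
  by rewrite subr0.
have h2 := @is_derive1_comp _ (fun w : R => w `^ (1 - q)) (fun z =>
  z - a) x _ _ (is_derive1_powR (1 - q) xa0) h1.
have h3 : is_derive x 1 (fun z => (k / (1 - q)) *: ((fun w : R =>
  w `^ (1 - q)) \o (fun z => z - a)) z)
   (k * (x - a) `^ (- q)).
  apply: is_derive_eq.
  rewrite /GRing.scale /= (_ : 1 - q - 1 = - q); last by ring.
  by field.
rewrite (_ : (fun z => _) = (fun z => (k / (1 - q)) *: ((fun w : R =>
  w `^ (1 - q)) \o (fun z => z - a)) z)) //.
by apply/funext => z /=; rewrite /GRing.scale /=; field.
Qed.

(** For fixed [x], h y - h a is the sum of h y - h x and the constant h x - h a. The first part is
    differentiated through [holder_remainder], the second contributes an explicit power of z - a. *)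
Lemma is_derive_RL_integral_holder (alpha q C a b x : R) (h : R -> R) :
  0 < q -> q < alpha -> alpha < 1 -> 0 <= C ->
  (forall x y, a <= x < b -> a <= y < b -> `|h x - h y| <= C * `|x - y| `^ alpha) ->
  a < x < b ->
  is_derive x 1 (RL_integral q (fun y => h y - h a) a)
    (marchaud q a h x + (h x - h a) * (x - a) `^ (- q)).
Proof.
move=> q0 qa al1 C0 hC /andP[ax xb].
have q1 := lt_trans qa al1.
have eta0 : 0 < alpha - q by rewrite subr_gt0.
pose M1 := 6 * C / (1 - q) + C / (alpha - q).
pose M2 := 4 * C * ((x - a) `^ ((alpha - q) / 2) / ((alpha - q) / 2)).
have dK : is_derive x 1 (centered_RL_integral q a h x) (marchaud q a h x).
  apply: (@is_derive_of_remainder _ _ _ _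
    (fun u => M1 * (3 * u) `^ (alpha - q) + M2 * u `^ ((alpha - q) / 2))).
    rewrite [X in _ --> X](_ : 0 = M1 * (3 `^ (alpha - q) * 0) + M2 * 0);
      last by rewrite !mulr0 addr0.
    apply: cvgD; apply: cvgMr; last by apply: powR_cvg0; rewrite divr_gt0.
    apply: (@cvg_trans _ ((3 `^ (alpha - q) * u `^ (alpha - q)) @[u --> 0^'+])).
      apply: near_eq_cvg; near=> u; have u0 : 0 < u by near: u; exact: nbhs_right_gt.
      by rewrite /= powRM// ltW.
    by apply: cvgMr; exact: powR_cvg0.
  near=> t; apply: (holder_remainder q0 qa al1 C0 hC).
  - by rewrite ax.
  - by near: t; exact: nbhs_dnbhs_neq.
  - rewrite -mulr2n -mulr_natr -ltr_pdivlMr//; near: t.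
    by apply: dnbhs0_lt; rewrite divr_gt0// subr_gt0.
  - rewrite -ltrBrDl; near: t; apply: nbhs_dnbhs.
    by apply: lt_nbhsl; rewrite subr_gt0.
have dP := is_derive_powR_shift (h x - h a) q1 ax.
apply: near_eq_is_derive (is_deriveD dK dP).
near=> z.
have az : a < z by near: z; exact: lt_nbhsr.
have zb : z < b by near: z; exact: lt_nbhsl.
have kE (k : R) : RL_kernel q (fun y => h y - k) z = (fun y =>
  (h y - k) * (z - y) `^ (- q)).
  by apply/funext => y; rewrite /RL_kernel powRN.
rewrite (RL_integral_subcst (h x - h a) q1 az).
  congr (_ + _); rewrite /RL_integral /centered_RL_integral.
  apply: eq_Rintegral => y _; rewrite /RL_kernel powRN; congr (_ / _); ring.
rewrite kE; apply: (integrable_holder_kernel q0 qa al1 C0 hC);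
  rewrite ?lexx ?az ?(ltW zb)//.
exact: lt_trans zb.
Unshelve. all: by end_near.
Qed.

(** Both terms of the derivative are bounded by a multiple of (x - a)^(alpha - q): the Marchaud term
    by [norm_marchaud_le], the other by the Hölder condition at [a]. The limit is therefore 0. *)
Lemma locally_frac_differentiable_holder (alpha q C a b : R) (h : R -> R) :
  0 < q -> q < alpha -> alpha < 1 -> 0 <= C -> a < b ->
  (forall x y, a <= x < b -> a <= y < b -> `|h x - h y| <= C * `|x - y| `^ alpha) ->
  locally_frac_differentiable q h a.
Proof.
move=> q0 qa al1 C0 ab hC.
have q1 := lt_trans qa al1.
have eta0 : 0 < alpha - q by rewrite subr_gt0.
have dJ x (axb : a < x < b) := is_derive_RL_integral_holder q0 qa al1 C0 hC axb.
split.
  near=> x.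
  have ax : a < x by near: x; exact: nbhs_right_gt.
  have xb : x < b by near: x; exact: nbhs_right_lt.
  have axb : a < x < b by rewrite ax.
  split; last by case: (dJ x axb).
  near=> z.
  have az : a < z by near: z; exact: lt_nbhsr.
  have zb : z < b by near: z; exact: lt_nbhsl.
  rewrite (_ : RL_kernel _ _ _ = (fun y => (h y - h a) * (z - y) `^ (- q))).
    by apply: (integrable_holder_kernel q0 qa al1 C0 hC); rewrite ?lexx ?az ?(ltW zb).
  by apply/funext => y; rewrite /RL_kernel powRN.
apply/cvg_ex; exists 0.
pose M := `|(Gamma (1 - q))^-1| * (q * (C / (alpha - q)) + C).
have cM : M * (x - a) `^ (alpha - q) @[x --> a^'+] --> (0 : R).
  rewrite -(mulr0 M); apply: cvgMr.
  apply: (@cvg_comp _ _ _ (fun x => x - a) (fun u => u `^ (alpha - q)) _ 0^'+).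
    exact: cvg_sub_at_right.
  exact: powR_cvg0.
apply/cvgrPdist_le => e e0; move/cvgrPdist_le : cM => /(_ e e0).
apply: filterS3 (nbhs_right_lt ab) (nbhs_right_gt a) => x xb ax.
rewrite !sub0r !normrN; apply: le_trans.
have axb : a < x < b by rewrite ax.
have xa0 : 0 < x - a by rewrite subr_gt0.
case: (dJ x axb) => _ dE; rewrite /RL_derivative derive1E dE.
apply: le_trans (ler_norm _).
rewrite normrM /M -mulrA; apply: ler_wpM2l => //.
apply: (le_trans (ler_normD _ _)); rewrite [leRHS]mulrDl; apply: lerD.
  apply: le_trans (norm_marchaud_le q0 qa C0 hC axb) _.
  by rewrite -!mulrA (mulrC _^-1).
rewrite normrM [X in _ * X]ger0_norm ?powR_ge0//.
rewrite powRD ?(gt_eqF xa0) ?implybT// mulrA ler_wpM2r ?powR_ge0//.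
apply: (le_trans (hC _ _ _ _)); rewrite ?lexx ?(ltW ax) ?xb//=.
by rewrite gtr0_norm.
Unshelve. all: by end_near.
Qed.

End holder_frac.

(** * One-sided signs of exponential sums *)

Section right_sign.
Context {R : realType}.
Implicit Types (F H dH k : R -> R) (y e : R).

(** The zero alternative is global, as for analytic functions: vanishing just to the right of one
    point then forces vanishing everywhere. *)
Definition right_signed F y := [\/ forall x, F x = 0,
  \forall x \near y^'+, 0 < F x | \forall x \near y^'+, F x < 0].

Lemma right_signedN F y : right_signed F y -> right_signed (\- F) y.
Proof.
case=> [F0|Fp|Fn]; [constructor 1 => x|constructor 3|constructor 2].
- by rewrite /= F0 oppr0.
- by apply: filterS Fp => x; rewrite oppr_lt0.
- by apply: filterS Fn => x; rewrite oppr_gt0.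
Qed.

Lemma right_signed_pMl k F y : (forall x, 0 < k x) ->
  right_signed (fun x => k x * F x) y -> right_signed F y.
Proof.
move=> k0 [F0|Fp|Fn]; [constructor 1 => x|constructor 2|constructor 3].
- by apply/eqP; have /eqP := F0 x; rewrite mulf_eq0 gt_eqF.
- by apply: filterS Fp => x; rewrite pmulr_rgt0.
- by apply: filterS Fn => x; rewrite pmulr_rlt0.
Qed.

Lemma is_derive_continuous H (x l : R) : is_derive x (1 : R) H l ->
  H z @[z --> x] --> H x.
Proof.
by case=> dH _; apply: differentiable_continuous; apply/derivable1_diffP.
Qed.

Lemma near_at_right_ex (y : R) (P : R -> Prop) : (\forall x \near y^'+, P x) ->
  exists2 e, 0 < e & forall x, y < x < y + e -> P x.
Proof.
case=> e /= e0 He; exists e => // x /andP[yx xe]; apply: He => //=.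
by rewrite distrC gtr0_norm ?subr_gt0// ltrBlDl.
Qed.

Lemma gt0_derive_increasing H dH y e : (forall x : R, is_derive x (1 : R) H (dH x)) ->
  (forall x, y < x < y + e -> 0 < dH x) ->
  forall u v, y <= u -> u < v -> v < y + e -> H u < H v.
Proof.
move=> HdH dH0 u v yu uv ve.
apply: (@gtr0_derive1_incr _ H u v) => //.
  move=> z; rewrite in_itv/= => /andP[uz zv]; rewrite derive1E.
  by case: (HdH z) => _ ->; apply: dH0; rewrite (le_lt_trans yu)//= (lt_trans zv).
by apply: continuous_subspaceT => z; exact: is_derive_continuous (HdH z).
Qed.

(** If H y < 0, continuity keeps [H] negative near [y]; otherwise the strict increase of [H] makes
    it positive just after [y]. *)
Lemma right_signed_primitive_gt0 H dH y : (forall x : R, is_derive x (1 :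
  R) H (dH x)) ->
  (\forall x \near y^'+, 0 < dH x) -> right_signed H y.
Proof.
move=> HdH /near_at_right_ex[e e0 dH0].
have [Hy|Hy] := ltP (H y) 0.
  constructor 3.
  exact: (cvg_at_right_filter (is_derive_continuous (HdH y)) (lt_nbhsl Hy)).
constructor 2; near=> x.
have yx : y < x by near: x; exact: nbhs_right_gt.
have xe : x < y + e by near: x; apply: nbhs_right_lt; rewrite ltrDl.
exact: le_lt_trans Hy (gt0_derive_increasing HdH dH0 (lexx y) yx xe).
Unshelve. all: by end_near.
Qed.

Lemma right_signed_primitive H dH y : (forall x : R, is_derive x (1 : R) H (dH x)) ->
  right_signed dH y -> right_signed H y.
Proof.
move=> HdH [dH0|dHp|dHn]; last 2 first.
- exact: right_signed_primitive_gt0 dHp.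
- have : right_signed (\- H) y; last first.
    move=> /right_signedN hN.
    by rewrite (_ : H = \- (\- H))//; apply/funext => x /=; rewrite opprK.
  apply: (@right_signed_primitive_gt0 _ (\- dH)).
  by apply: filterS dHn => x dx; rewrite /= oppr_gt0.
have Hc x : H x = H y.
  by apply: is_derive_0_is_cst => z; rewrite -(dH0 z).
have [Hy|Hy|Hy] := ltgtP (H y) 0; [constructor 3|constructor 2|constructor 1].
- by near=> x; rewrite Hc.
- by near=> x; rewrite Hc.
- by move=> x; rewrite Hc.
Unshelve. all: by end_near.
Qed.

End right_sign.

(** * Exponential sums: one-sided signs, linear independence, behaviour at -oo *)

Section exponential_sums.
Context {R : realType}.
Implicit Types (s : seq (R * R)).

Definition expsum s (x : R) : R := \sum_(p <- s) p.1 * expR (p.2 * x).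

Definition expsum_deriv s : seq (R * R) := [seq (p.1 * p.2, p.2) | p <- s].

Definition expsum_shift c s : seq (R * R) := [seq (p.1, p.2 - c) | p <- s].

Lemma expsum_shiftE c s x : expsum (expsum_shift c s) x = expR (- c * x) * expsum s x.
Proof.
rewrite /expsum big_map mulr_sumr; apply: eq_bigr => p _ /=.
by rewrite mulrCA -expRD; congr (_ * expR _); ring.
Qed.

Lemma is_derive_expsum s (x : R) : is_derive x (1 :
  R) (expsum s) (expsum (expsum_deriv s) x).
Proof.
elim: s => [|p s IH].
  rewrite (_ : expsum [::] = cst 0); last by apply/funext => z; rewrite /expsum big_nil.
  exact: is_derive_cst.
rewrite (_ : expsum (p :: s) = (fun z => p.1 * expR (p.2 * z)) + expsum s); last first.
  by apply/funext => z; rewrite /expsum big_cons.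
rewrite (_ : expsum (expsum_deriv (p :: s)) x =
  p.1 * p.2 * expR (p.2 * x) + expsum (expsum_deriv s) x); last first.
  by rewrite /expsum big_cons.
apply: is_deriveD.
have h1 : is_derive x (1 : R) (fun z => p.2 * z) p.2.
  have := is_deriveZ p.2 (is_derive_id x (1 : R)); rewrite /GRing.scale/= mulr1; exact.
have h2 := @is_derive1_comp _ expR (fun z => p.2 * z) x _ _ (is_derive_expR _) h1.
have := is_deriveZ p.1 h2; rewrite /GRing.scale/=.
by rewrite (mulrC _ p.2) mulrA; exact.
Qed.

(* Dividing by one of the exponentials and differentiating removes one term. *)
Lemma right_signed_expsum s (y : R) : right_signed (expsum s) y.
Proof.
have [n] := ubnP (size s); elim: n s => // n IH [|[a g] s] sn.
  by constructor 1 => x; rewrite /expsum big_nil.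
apply: (@right_signed_pMl _ (fun x => expR (- g * x))).
  by move=> x; exact: expR_gt0.
rewrite (_ : (fun x => _) = expsum (expsum_shift g ((a, g) :: s))); last first.
  by apply/funext => x; rewrite expsum_shiftE.
apply: (@right_signed_primitive _ _ (expsum (expsum_deriv (expsum_shift g s))));
  last first.
  by apply: IH; rewrite !size_map.
move=> x; apply: is_derive_eq (is_derive_expsum _ _) _.
by rewrite /expsum /= big_cons/= subrr mulr0 mul0r add0r.
Qed.

(** Linear independence of exponentials, by the same elimination of one term. The surviving
    coefficients are multiplied by differences of exponents, nonzero by uniqueness, so the induction
    leaves a single term, which is nonzero at 0. *)
Lemma expsum_eq0 s : uniq (unzip2 s) -> all (fun p => p.1 != 0) s ->
  (forall x, expsum s x = 0) -> s = [::].
Proof.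
have [n] := ubnP (size s);
  elim: n s => // n IH [|[a g] s] //= sn /andP[gs us] /andP[a0 s0] E0.
have : expsum_deriv (expsum_shift g s) = [::].
  apply: IH.
  - by rewrite !size_map.
  - rewrite /unzip2 -!map_comp (eq_map (_ : _ =1 (fun p => p - g) \o snd))//.
    by rewrite map_comp map_inj_uniq// => u v /addIr.
  - apply/allP => p /mapP[r /mapP[t ts -> ->]] /=.
    rewrite mulf_neq0 ?(allP s0 _ ts)// subr_eq0.
    by apply: contraNneq gs => <-; exact: map_f.
  move=> x; have := is_derive_expsum (expsum_shift g ((a, g) :: s)) x.
  rewrite (_ : expsum (expsum_shift _ _) = cst 0); last first.
    by apply/funext => z; rewrite expsum_shiftE E0 mulr0.
  case=> _; rewrite derive_cst /expsum /= big_cons/= subrr mulr0 mul0r add0r.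
  by move=> <-.
case: s E0 {gs us s0 sn} => // E0 _; have := E0 0.
by rewrite /expsum big_cons big_nil/= mulr0 expR0 mulr1 addr0 => /eqP;
  rewrite (negbTE a0).
Qed.

Lemma cvg_expsum_Ny s : all (fun p => 0 < p.2) s -> expsum s (- x) @[x --> +oo] --> 0.
Proof.
elim: s => [|p s IH] /=.
  by move=> _; rewrite /expsum; under eq_fun do rewrite big_nil; exact: cvg_cst.
move=> /andP[p0 /IH {}IH].
rewrite (_ : (fun x => _) = (fun x => p.1 * expR (- (p.2 * x)) + expsum s (- x)));
  last first.
  by apply/funext => x; rewrite /expsum big_cons mulrN.
rewrite -(addr0 0); apply: cvgD => //; rewrite -(mulr0 p.1); apply: cvgMr.
apply: (@cvg_comp _ _ _ (fun x => p.2 * x) (fun x => expR (- x)) _ (+oo));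
  last exact: cvgr_expR.
exact: gt0_cvgMry.
Qed.

(** The sum is constant, and positive exponents make it tend to 0 at -oo. *)
Lemma expsum_deriv_eq0 s : all (fun p => 0 < p.2) s ->
  (forall x, expsum (expsum_deriv s) x = 0) -> forall x, expsum s x = 0.
Proof.
move=> s0 ds0 x.
have Ec z : expsum s z = expsum s x.
  by apply: is_derive_0_is_cst => u; rewrite -(ds0 u); exact: is_derive_expsum.
have := cvg_expsum_Ny s0; under eq_fun do rewrite Ec.
have h : expsum s x @[_ --> (+oo : set_system R)] --> expsum s x by exact: cvg_cst.
by move=> /(cvg_unique _ h) ->.
Qed.

End exponential_sums.

(** * Sums weighted by inverse factorials *)

Section factorial_sums.
Context {R : realType}.
Implicit Types (u v : nat -> R) (M : R).

(** The weights 1/n! make bounded sequences summable and decrease fast enough for the integrality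
    argument of [wsum_int_eq0]. *)
Definition wterm u : nat -> R := fun n => u n / n`!%:R.
Definition wsum u : R := limn (series (wterm u)).

Let fact_gt0R n : 0 < n`!%:R :> R. Proof. by rewrite ltr0n fact_gt0. Qed.

Lemma is_cvg_wsum u M : (forall n, `|u n| <= M) -> cvgn (series (wterm u)).
Proof.
move=> uM; apply: normed_cvg.
have M0 : 0 <= M by apply: le_trans (uM 0%N).
apply: (@series_le_cvg _ _ (fun n => M * exp_coeff 1 n)).
- by move=> n /=.
- by move=> n; rewrite mulr_ge0// /exp_coeff/= divr_ge0// exprn_ge0.
- move=> n; rewrite /wterm /exp_coeff/= expr1n mul1r normrM normfV [X in _ /
  X]ger0_norm//.
  by rewrite ler_wpM2r// invr_ge0.
rewrite (_ : (fun n => _) = M *: exp_coeff 1); last by apply/funext.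
by apply: is_cvg_seriesZ; exact: is_cvg_series_exp_coeff.
Qed.

Lemma cvg_wsum u M : (forall n, `|u n| <= M) -> series (wterm u) @ \oo --> wsum u.
Proof. by move=> uM; exact: (is_cvg_wsum uM). Qed.

Lemma wsumB u v M M' : (forall n, `|u n| <= M) -> (forall n, `|v n| <= M') ->
  wsum (fun n => u n - v n) = wsum u - wsum v.
Proof.
move=> uM vM; rewrite /wsum -lim_seriesB;
  [|exact: is_cvg_wsum uM|exact: is_cvg_wsum vM].
by congr (limn (series _)); apply/funext => n; rewrite /wterm mulrBl.
Qed.

Lemma wsumZ u k M : (forall n, `|u n| <= M) -> wsum (fun n => k * u n) = k * wsum u.
Proof.
move=> uM; rewrite /wsum -[RHS]lim_seriesZ; last exact: is_cvg_wsum uM.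
by congr (limn (series _)); apply/funext => n; rewrite /wterm -mulrA.
Qed.

Lemma wsum_sum (I : Type) (r : seq I) (u : I -> nat -> R) (k : I -> R) M :
  (forall i n, `|u i n| <= M) ->
  wsum (fun n => \sum_(i <- r) k i * u i n) = \sum_(i <- r) k i * wsum (u i).
Proof.
move=> uM; elim: r => [|i r IH].
  rewrite big_nil /wsum (_ : wterm _ = fun=> 0).
    by rewrite (_ : series _ = cst 0) ?lim_cst//; apply/funext => n;
      rewrite /series/= big1.
  by apply/funext => n; rewrite /wterm big_nil mul0r.
rewrite big_cons -IH.
have bZ (j : I) n : `|- k j * u j n| <= `|k j| * M.
  by rewrite normrM normrN ler_wpM2l.
rewrite -(opprK (k i)) mulNr -(wsumZ _ (uM i)) addrC.
rewrite -(@wsumB _ _ (\sum_(j <- r) `|k j| * M) _ _ (bZ i)).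
  by congr wsum; apply/funext => n; rewrite big_cons mulNr opprK addrC.
move=> n; apply: (le_trans (ler_norm_sum _ _ _)); apply: ler_sum => j _.
by rewrite normrM ler_wpM2l.
Qed.

Lemma le_wsum u v M M' : (forall n, `|u n| <= M) -> (forall n, `|v n| <= M') ->
  (forall n, u n <= v n) -> wsum u <= wsum v.
Proof.
move=> uM vM uv; apply: lim_series_le; [exact: is_cvg_wsum uM|exact: is_cvg_wsum vM|].
by move=> n; rewrite /wterm ler_wpM2r// invr_ge0.
Qed.

Lemma wsum_ge_term u M n : (forall n, `|u n| <= M) -> (forall n, 0 <= u n) ->
  u n / n`!%:R <= wsum u.
Proof.
move=> uM u0.
have nd : nondecreasing_seq (series (wterm u)).
  by apply: nondecreasing_series => k _ _; rewrite /wterm divr_ge0.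
have := nondecreasing_cvgn_le nd (is_cvg_wsum uM) n.+1.
apply: le_trans; rewrite /series/= big_nat_recr//= lerDr sumr_ge0// => i _.
by rewrite /wterm divr_ge0.
Qed.

Lemma norm_wsum u M : (forall n, `|u n| <= M) -> `|wsum u| <= M * wsum (fun=> 1).
Proof.
move=> uM.
have M0 : 0 <= M by apply: le_trans (uM 0%N).
have b1 (n : nat) : `|1 : R| <= 1 by rewrite normr1.
have bM (k : R) (n : nat) : `|k * 1| <= `|k| by rewrite mulr1.
have uM' n : - M <= u n <= M by rewrite -ler_norml.
rewrite ler_norml -mulNr -!(wsumZ _ b1); apply/andP; split.
  by apply: (le_wsum (bM _) uM) => n; rewrite mulr1; case/andP: (uM' n).
by apply: (le_wsum uM (bM _)) => n; rewrite mulr1; case/andP: (uM' n).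
Qed.

Lemma wsum1_ge0 : 0 <= wsum (fun=> 1).
Proof.
have b1 (n : nat) : `|1 : R| <= 1 by rewrite normr1.
by have := norm_wsum b1; rewrite mul1r; exact: le_trans.
Qed.

Lemma fact_tail (N K : nat) : (0 < N)%N -> (N <= K)%N ->
  \sum_(N <= n < K) (n`!%:R)^-1 <= 2 / N`!%:R :> R.
Proof.
move=> N0 NK.
(* The subtracted term makes the bound telescope: 1/K! <= 2/K! - 2/(K+1)! because K + 1 >= 2. *)
suff : \sum_(N <= n < K) (n`!%:R)^-1 <= 2 / N`!%:R - 2 / K`!%:R :> R.
  by move=> h; apply: (le_trans h); rewrite gerBl divr_ge0.
elim: K NK => [|K IH]; first by rewrite leqn0 => /eqP N0'; rewrite N0' in N0.
rewrite leq_eqVlt => /predU1P[<-|]; first by rewrite big_geq// subrr.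
rewrite ltnS => NK; rewrite big_nat_recr//=.
apply: (le_trans (lerD (IH NK) (lexx _))).
have K1 : (2 : R) <= K.+1%:R by rewrite ler_nat ltnS (leq_trans N0).
have -> : K.+1`!%:R = K.+1%:R * K`!%:R :> R by rewrite factS natrM.
have h : 2 / (K.+1%:R * K`!%:R) <= (K`!%:R)^-1 :> R.
  by rewrite invfM mulrA ger_pMl ?invr_gt0// ler_pdivrMr ?mul1r ?ltr0n.
apply: (@le_trans _ _ (2 / N`!%:R - (K`!%:R)^-1)); last by rewrite lerD2l lerN2;
  exact: h.
by rewrite le_eqVlt; apply/orP; left; apply/eqP; ring.
Qed.

(* N! times the sum of the terms up to N is an integer, and by [fact_tail] it tends to 0. *)
Lemma wsum_int_eq0 (u : nat -> int) (M : nat) : (forall n, (`|u n| <= M)%N) ->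
  wsum (fun n => (u n)%:~R) = 0 -> exists N, forall n, (N < n)%N -> u n = 0.
Proof.
move=> uM u0.
have uMR n : `|(u n)%:~R : R| <= M%:R.
  by rewrite -intr_norm -[M%:R]/((Posz M)%:~R) ler_int; have := uM n; lia.
pose S n := series (wterm (fun n => (u n)%:~R)) n.
have Scv : S @ \oo --> (0 : R) by rewrite -u0; exact: cvg_wsum uMR.
have SS n : S n.+1 = S n + (u n)%:~R / n`!%:R by rewrite /S /series/= big_nat_recr.
have Sint N : exists z : int, N`!%:R * S N.+1 = z%:~R.
  elim: N => [|N [z IH]].
    exists (u 0%N); rewrite SS /S /series/= big_geq// add0r fact0.
    by rewrite divr1 mul1r.
  exists (N.+1%:Z * z + u N.+1).
  rewrite SS mulrDr mulrCA divff ?gt_eqF// mulr1 factS natrM -mulrA IH.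
  by rewrite intrD intrM.
(* The full sum is 0, so [S N] is the opposite of a tail, bounded through [fact_tail]. *)
have Sle N : (0 < N)%N -> `|S N| <= M%:R * (2 / N`!%:R).
  move=> N0.
  have : `|S K - S N| @[K --> \oo] --> `|0 - S N|.
    by apply: cvg_norm; apply: cvgB => //; exact: cvg_cst.
  have h : (fun=> M%:R * (2 / N`!%:R) : R) @ \oo --> (M%:R * (2 / N`!%:R) :
    R) by exact: cvg_cst.
  move=> /ler_cvg_to /(_ h); rewrite sub0r normrN; apply.
  exists N => // K /= NK.
  rewrite sub_series_geq//; apply: (le_trans (ler_norm_sum _ _ _)).
  apply: (le_trans _ (ler_wpM2l _ (fact_tail N0 NK))) => //.
  rewrite mulr_sumr; apply: ler_sum => n _.
  by rewrite /wterm normrM normfV [X in _ / X]ger0_norm// ler_wpM2r// invr_ge0.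
(* The integer N! S(N+1) has absolute value at most 2M/(N+1), which is below 1 once N >= 2M. *)
have S0 N : (M.*2 <= N)%N -> S N.+1 = 0.
  move=> MN; have [z zE] := Sint N.
  have z1 : `|z%:~R : R| < 1.
    rewrite -zE normrM ger0_norm//.
    apply: (le_lt_trans (ler_wpM2l (ltW (fact_gt0R N)) (Sle N.+1 isT))).
    rewrite factS natrM invfM.
    rewrite [ltLHS](_ : _ = (M%:R * 2) / N.+1%:R); last by field; rewrite !gt_eqF.
    by rewrite ltr_pdivrMr// mul1r -natrM ltr_nat ltnS muln2.
  have z0 : z = 0.
    by move: z1; rewrite -intr_norm -[1]/(1%:~R) ltr_int; lia.
  by move: zE; rewrite z0 => /eqP; rewrite mulf_eq0 gt_eqF//= => /eqP.
(* A term is the difference of two consecutive partial sums, and both must lie in the range where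
   they vanish. *)
exists M.*2.+1 => n Mn.
have := SS n; case: n Mn => // n Mn.
rewrite !S0 ?(leq_trans _ (ltnW Mn))//; last by rewrite -ltnS ltnW.
rewrite add0r => /esym/eqP; rewrite mulf_eq0 invr_eq0 [X in _ || X]gt_eqF// orbF.
by rewrite intr_eq0 => /eqP.
Qed.

End factorial_sums.

(** * The rough function and the independent exponents *)

Section rational_sequence.
Context {R : realType}.

(** An index that codes no rational gives 0; every rational occurs at its [pickle] index. *)
Definition rat_seq (n : nat) : R := ratr (odflt 0 (unpickle n : option rat)).

(** Avoiding the first [N] terms one by one leaves a nonempty open subinterval, and any rational in
    it has a larger index. Arbitrarily large indices are what [exponent_independent] relies on. *)
Lemma rat_seq_dense (N : nat) (u v : R) : u < v ->
  exists2 n, (N <= n)%N & u < rat_seq n < v.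
Proof.
move=> uv.
have [[u' v'] /= [uu' u'v' v'v hN]] : exists w :
  R * R, [/\ u <= w.1, w.1 < w.2, w.2 <= v &
    forall n, (n < N)%N -> ~~ (w.1 < rat_seq n < w.2)].
  elim: N => [|N [[u' v'] /= [uu' u'v' v'v hN]]]; first by exists (u, v).
  have [/andP[h1 h2]|h] := boolP (u' < rat_seq N < v').
    exists (u', rat_seq N) => /=; split => //; first by rewrite (le_trans (ltW h2)).
    move=> n; rewrite ltnS leq_eqVlt => /predU1P[->|nN]; first by rewrite ltxx andbF.
    apply/negP => /andP[h3 h4]; have /negP := hN n nN; apply.
    by rewrite h3 (lt_trans h4).
  exists (u', v') => /=; split => // n; rewrite ltnS leq_eqVlt => /predU1P[->//|].
  exact: hN.
have [q] := rat_in_itvoo u'v'; rewrite in_itv/= => /andP[h1 h2].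
have qE : rat_seq (pickle q) = ratr q by rewrite /rat_seq pickleK.
exists (pickle q); last by rewrite qE (le_lt_trans uu')// (lt_le_trans h2).
rewrite leqNgt; apply/negP => /hN; rewrite qE h1 h2; exact.
Qed.

End rational_sequence.

(** * Truncated powers *)

Section powR_clamped.
Context {R : realType}.
Implicit Types (alpha s t : R).

(** Each ratio w / (s + t) lies in [0, 1], where raising to the power alpha <= 1 does not decrease
    it; the two ratios add up to 1. *)
Lemma powR_subadditive alpha s t : 0 < alpha <= 1 -> 0 <= s -> 0 <= t ->
  (s + t) `^ alpha <= s `^ alpha + t `^ alpha.
Proof.
move=> /andP[a0 a1]; rewrite le_eqVlt => /predU1P[<-|s0].
  by rewrite add0r lerDr powR_ge0.
rewrite le_eqVlt => /predU1P[<-|t0]; first by rewrite addr0 lerDl powR_ge0.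
have st0 : 0 < s + t by exact: addr_gt0.
have le_frac (w : R) : 0 < w -> w <= s + t ->
  w / (s + t) * (s + t) `^ alpha <= w `^ alpha.
  move=> w0 wst.
  have w1 : 0 < w / (s + t) <= 1 by rewrite divr_gt0//= ler_pdivrMr// mul1r.
  have -> : w `^ alpha = (w / (s + t)) `^ alpha * (s + t) `^ alpha.
    by rewrite -powRM ?divfK ?gt_eqF// ltW//; case/andP: w1.
  by rewrite ler_wpM2r ?powR_ge0// ger1_powR.
have := lerD (le_frac s s0 _) (le_frac t t0 _).
rewrite lerDl lerDr -mulrDl -mulrDl divff ?gt_eqF// mul1r.
by apply; exact: ltW.
Qed.

Definition clamp_powR alpha t := Num.min (Num.max t 0) 1 `^ alpha.

Lemma clamp_powR_ge0 alpha t : 0 <= clamp_powR alpha t.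
Proof. exact: powR_ge0. Qed.

Let clamp_ge0 t : 0 <= Num.min (Num.max t 0) 1.
Proof. by rewrite le_min ler01 andbT le_max lexx orbT. Qed.

Lemma clamp_powR_le1 alpha t : 0 <= alpha -> clamp_powR alpha t <= 1.
Proof.
move=> a0; have <- : 1 `^ alpha = 1 :> R by rewrite powR1.
rewrite ge0_ler_powR ?nnegrE//.
by rewrite ge_min lexx orbT.
Qed.

Lemma clamp_powR_homo alpha : 0 <= alpha -> {homo clamp_powR alpha : s t / s <= t}.
Proof.
move=> a0 s t st; rewrite ge0_ler_powR ?nnegrE//.
by rewrite le_min2 ?le_max2.
Qed.

(** Truncation to [0, 1] is 1-Lipschitz, and the power is subadditive. *)
Lemma clamp_powR_holder alpha s t : 0 < alpha <= 1 ->
  `|clamp_powR alpha s - clamp_powR alpha t| <= `|s - t| `^ alpha.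
Proof.
move=> a01; have /andP[a0 _] := a01.
wlog st : s t / t <= s.
  move=> H; have [|/ltW] := leP t s; first exact: H.
  by rewrite distrC (distrC s); exact: H.
rewrite !ger0_norm ?subr_ge0//; last by apply: clamp_powR_homo => //; exact: ltW.
rewrite lerBlDl /clamp_powR.
apply: le_trans (powR_subadditive a01 (clamp_ge0 t) _); last by rewrite subr_ge0.
apply: ge0_ler_powR; rewrite ?nnegrE ?(ltW a0)//.
  by rewrite addr_ge0 ?subr_ge0.
have m0 : Num.min 0 1 = 0 :> R by apply/min_idPl; exact: ler01.
case: (leP s 0) => hs; case: (leP t 0) => ht; rewrite ?m0;
  case: (leP s 1) => s1; case: (leP t 1) => t1; lra.
Qed.

Lemma clamp_powR0 alpha t : 0 < alpha -> t <= 0 -> clamp_powR alpha t = 0.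
Proof.
move=> a0 t0; rewrite /clamp_powR (max_idPr t0) (min_idPl ler01) powR0//.
by rewrite gt_eqF.
Qed.

Lemma clamp_powRE alpha t : 0 <= t <= 1 -> clamp_powR alpha t = t `^ alpha.
Proof. by move=> /andP[t0 t1]; rewrite /clamp_powR (max_idPl t0) (min_idPl t1). Qed.

End powR_clamped.

Section rough_function.
Context {R : realType} (alpha : R) (alpha01 : 0 < alpha < 1).
Implicit Types (x y t : R).

Definition rough x : R := wsum (fun n => clamp_powR alpha (x - rat_seq n)).

Let a0 : 0 < alpha. Proof. by case/andP: alpha01. Qed.
Let a01 : 0 < alpha <= 1. Proof. by case/andP: alpha01 => -> /ltW. Qed.

Let clamp_bound t : `|clamp_powR alpha t| <= 1.
Proof. by rewrite ger0_norm ?clamp_powR_ge0// clamp_powR_le1 ?ltW. Qed.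

Lemma rough_holder x y : `|rough x - rough y| <= wsum (fun=> 1) * `|x - y| `^ alpha.
Proof.
rewrite /rough -(@wsumB _ _ _ 1 1) // mulrC; apply: norm_wsum => n.
apply: (le_trans (clamp_powR_holder _ _ a01)).
by rewrite opprB addrA subrK.
Qed.

(** Every term of the series is nondecreasing in its argument, so any single one bounds the total
    increment from below. *)
Lemma rough_increment n x y : x <= y ->
  (clamp_powR alpha (y - rat_seq n) - clamp_powR alpha (x - rat_seq n)) / n`!%:R <=
  rough y - rough x.
Proof.
move=> xy; rewrite /rough -(@wsumB _ _ _ 1 1) //.
pose u k := clamp_powR alpha (y - rat_seq k) - clamp_powR alpha (x - rat_seq k).
apply: (@wsum_ge_term _ u 2) => k.
  by apply: (le_trans (ler_normB _ _)); rewrite -[2]/(1 + 1) lerD.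
by rewrite /u subr_ge0; apply: (clamp_powR_homo (ltW a0)); exact: lerB.
Qed.

Lemma rough_steep n t : 0 <= t <= 1 ->
  (n`!%:R)^-1 * t `^ alpha <= rough (rat_seq n + t) - rough (rat_seq n).
Proof.
move=> t01; have /andP[t0 t1] := t01.
rewrite (addrC _ t); have := @rough_increment n (rat_seq n) (t + rat_seq n).
rewrite lerDr => /(_ t0); rewrite addrK subrr.
by rewrite clamp_powRE// clamp_powR0// subr0 mulrC.
Qed.

Lemma rough_increasing x y : x < y -> rough x < rough y.
Proof.
move=> xy; have [n _ /andP[xn ny]] := rat_seq_dense 0 xy.
rewrite -subr_gt0; apply: lt_le_trans (rough_increment n (ltW xy)).
rewrite divr_gt0 ?ltr0n ?fact_gt0// (@clamp_powR0 _ _ (x - _))// ?subr0;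
  last by rewrite subr_le0 ltW.
by apply: powR_gt0; rewrite lt_min lt_max subr_gt0 ny ltr01.
Qed.

End rough_function.

(** * Exponents linearly independent over the integers *)

Section independent_exponents.
Context {R : realType}.

Definition exponent (c : R) : R := wsum (fun n => (rat_seq n < c)%R%:R).

Let bool_bound (b : bool) : `|b%:R : R| <= 1.
Proof. by case: b; rewrite ?normr0 ?normr1. Qed.

Lemma exponent_gt0 c : 0 < exponent c.
Proof.
have [n _ /andP[_ nc]] : exists2 n, (0 <= n)%N & c - 1 < rat_seq n < c.
  by apply: rat_seq_dense; rewrite ltrBlDr ltrDl.
apply: lt_le_trans (@wsum_ge_term _ (fun n => (rat_seq n < c)%R%:R) 1 n _ _) => //.
by rewrite nc divr_gt0// ltr0n fact_gt0.
Qed.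

(** Let c j be the largest c i with a nonzero coefficient. At rationals just below c j, the integer
    [u n] reduces to m j. Such rationals have arbitrarily large index, while [wsum_int_eq0] makes
    [u n] vanish eventually. *)
Lemma exponent_independent k (c : 'I_k -> R) (m : 'I_k -> int) : injective c ->
  \sum_i (m i)%:~R * exponent (c i) = 0 -> forall i, m i = 0.
Proof.
move=> cinj m0 i; apply/eqP/negPn/negP => mi.
have [j mj jmax] := @Order.TotalTheory.arg_maxP _ _ _ i (fun i => m i != 0) c mi.
(* The default [c j - 1] keeps [L] below [c j] when no other value is smaller. *)
pose L := \big[Num.max/(c j - 1)]_(l | c l < c j) c l.
have Lc : L < c j by apply: bigmax_lt => //; rewrite ltrBlDr ltrDl.
pose u n : int := \sum_i m i * (rat_seq n < c i)%R%:R.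
have [N hN] : exists N, forall n, (N < n)%N -> u n = 0.
  apply: (@wsum_int_eq0 R _ (\sum_i `|m i|)%N).
    move=> n; rewrite /u; apply: (@leq_trans (\sum_i `|(m i * (rat_seq n < c
      i)%R%:R)%R|)%N).
      elim/big_ind2: _ => // [x1 x2 y1 y2 h1 h2]; first lia.
    by apply: leq_sum => l _; rewrite abszM; case: (_ < _); lia.
  rewrite -[RHS]m0 /exponent -(@wsum_sum _ _ _ _ _ 1)//.
  congr wsum; apply/funext => n; rewrite /u rmorph_sum/=; apply: eq_bigr => l _.
  by rewrite rmorphM/=; case: (_ < _).
have [n Nn /andP[Ln nc]] := rat_seq_dense N.+1 Lc.
have := hN n Nn; rewrite /u (bigD1 j)//= nc mulr1 big1 ?addr0; first by move/eqP;
  apply/negP.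
move=> l lj; have [lt_lj|gt_lj|/cinj eq_lj] := ltgtP (c l) (c j).
- rewrite [_ < c l]lt_gtF ?mulr0//.
  by apply: le_lt_trans Ln; exact: le_bigmax_cond.
- have [->|ml] := eqVneq (m l) 0; first by rewrite mul0r.
  by have /(lt_le_trans gt_lj) := jmax l ml; rewrite ltxx.
- by rewrite eq_lj eqxx in lj.
Qed.

End independent_exponents.

(** * Exponential sums of the rough function *)

Section rough_compositions.
Context {R : realType} (alpha : R) (alpha01 : 0 < alpha < 1).
Local Notation rough := (rough alpha).

Lemma rough_continuous (x : R) : rough y @[y --> x] --> rough x.
Proof.
have [a0 _] := andP alpha01.
apply: (@holder_cvg _ (wsum (fun=> 1)) alpha) => //.
  exact: wsum1_ge0.
by near=> y; exact: rough_holder.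
Unshelve. all: by end_near.
Qed.

Lemma steep_of_derive_gt0 (F : R -> R) (u l : R) : is_derive u (1 : R) F l -> 0 < l ->
  \forall v \near u^'+, l / 2 * (v - u) <= F v - F u.
Proof.
move=> [dF Fl] l0.
have cv : h^-1 *: (F (h *: 1 + u) - F u) @[h --> (0 : R)^'+] --> l.
  by apply: cvg_dnbhs_at_right; rewrite -Fl; exact: dF.
have l2 : l / 2 < l by rewrite ltr_pdivrMr// ltr_pMr// ltr1n.
have h : \forall h \near (0 : R)^'+, l / 2 < h^-1 *: (F (h *: 1 + u) - F u).
  exact: (cv _ (lt_nbhsr l2)).
have := @cvg_sub_at_right R u _ h.
apply: filterS2 (nbhs_right_gt u) => v uv /=.
rewrite /GRing.scale/= mulr1 subrK -(ltr_pM2r (_ : 0 < v - u)) ?subr_gt0//.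
by move/ltW; rewrite [leRHS]mulrAC mulVf ?mul1r// subr_eq0 gt_eqF.
Qed.

(** Local differentiability at [a] requires the Riemann-Liouville derivative at all points just
    after [a]; it fails at a rational [r] there, where [rough] is steep and F o rough is increasing
    on [a, r]. *)
Lemma not_frac_differentiable_comp (F dF h : R -> R) (q a b : R) :
  (forall u : R, is_derive u (1 : R) F (dF u)) ->
  (\forall u \near (rough a)^'+, 0 < dF u) ->
  a < b -> (forall x, a <= x < b -> h x = F (rough x)) ->
  alpha < q < 1 ->
  ~ \forall x \near a^'+, RL_derivable q (fun y => h y - h a) a x.
Proof.
move=> dFF /near_at_right_ex[e e0 dF0] ab hF /andP[aq q1] nd.
have [a0 a1] := andP alpha01.
have rinc := rough_increasing alpha01.
have re : \forall x \near a^'+, rough x < rough a + e.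
  have ltae : rough a < rough a + e by rewrite ltrDl.
  exact: (cvg_at_right_filter (@rough_continuous a) (lt_nbhsl ltae)).
have : \forall x \near a^'+, [/\ RL_derivable q (fun y =>
  h y - h a) a x, rough x < rough a + e & x < b].
  by near=> x; split; near: x => //; exact: nbhs_right_lt.
move=> /near_at_right_ex[d d0 hd].
have [n _ nd'] : exists2 n, (0 <=
  n)%N & a < rat_seq n < a + d by apply: rat_seq_dense; rewrite ltrDl.
have [RLr rre rb] := hd _ nd'; have [ar _] := andP nd'.
set r := rat_seq n in RLr rre rb ar.
have Fmono x y : a <= x -> x < y -> y <= r -> F (rough x) <= F (rough y).
  move=> ax xy yr; apply: ltW; apply: (gt0_derive_increasing dFF dF0).
  - by move: ax; rewrite le_eqVlt => /predU1P[->//|/rinc/ltW].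
  - exact: rinc.
  - apply: le_lt_trans rre; move: yr; rewrite le_eqVlt => /predU1P[->//|/rinc/ltW//].
have dr : 0 < dF (rough r) by apply: dF0; rewrite rre rinc.
have /near_at_right_ex[k k0 hk] := steep_of_derive_gt0 (dFF (rough r)) dr.
have ltrk : rough r < rough r + k by rewrite ltrDl.
have : \forall x \near r^'+, [/\ rough x < rough r + k, x < b & x < r + 1].
  near=> x; split; near: x.
  - exact: (cvg_at_right_filter (@rough_continuous r) (lt_nbhsl ltrk)).
  - exact: nbhs_right_lt.
  - by apply: nbhs_right_lt; rewrite ltrDl.
move=> /near_at_right_ex[e' e'0 he'].
have ha := hF a; rewrite lexx ab in ha.
have hr : h r = F (rough r) by rewrite hF// (ltW ar).
(* The steepness constant is half the slope of [F] at [rough r] times the weight 1/n! of the term of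
   [rough] that is singular at [r]. *)
move: RLr; apply: (@not_RL_derivable_steep _ alpha q _ a r e' (dF (rough r) / 2 *
  (n`!%:R)^-1)) => //.
- by rewrite q1 (lt_trans a0).
- by rewrite !mulr_gt0// invr_gt0 ltr0n fact_gt0.
- exact: ltW.
- move=> y /andP[ay yr]; rewrite lerD2r hr hF ?(ltW ay) ?(lt_trans yr)//.
  by apply: Fmono => //; exact: ltW.
- by rewrite subr_ge0 hr ha//; apply: Fmono.
- move=> t /andP[t0 te].
  have [|rk rtb rt1] := he' (r + t); first by rewrite ltrDl t0 ltrD2l.
  rewrite opprB addrA subrK hr hF;
    last by rewrite rtb andbT ltW// (lt_trans ar)// ltrDl.
  apply: le_trans (hk (rough (r + t)) _); last by rewrite rk andbT; apply: rinc;
    rewrite ltrDl.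
  rewrite -mulrA ler_pM2l ?divr_gt0//.
  by apply: rough_steep => //; rewrite (ltW t0)/=; rewrite ltrD2l in rt1; exact: ltW.
Unshelve. all: by end_near.
Qed.

Lemma expsum_lipschitz (s : seq (R * R)) (m M : R) : exists2 L, 0 <= L &
  forall u v, m <= u <= M -> m <= v <= M -> `|expsum s u - expsum s v| <= L * `|u - v|.
Proof.
(* [L] bounds the derivative on [m, M], where every |x| is at most |m| + |M|; the mean value theorem
   concludes. *)
pose L := \sum_(p <- s) `|p.1 * p.2| * expR (`|p.2| * (`|m| + `|M|)).
have L0 : 0 <= L by apply: sumr_ge0 => p _; rewrite mulr_ge0// expR_ge0.
exists L => // u v.
wlog uv : u v / v <= u.
  move=> H hu hv; have [vu|/ltW uv] := leP v u; first exact: H.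
  by rewrite distrC (distrC u); exact: H.
move=> /andP[mu uM] /andP[mv vM].
have [||c] := @MVT_segment R (expsum s) (expsum (expsum_deriv s)) v u uv.
- by move=> x _; exact: is_derive_expsum.
- by apply: continuous_subspaceT => x;
  exact: is_derive_continuous (is_derive_expsum s x).
rewrite in_itv/= => /andP[vc cu] ->; rewrite normrM ler_wpM2r//.
rewrite /expsum big_map; apply: (le_trans (ler_norm_sum _ _ _));
  apply: ler_sum => p _ /=.
rewrite normrM [X in _ * X]gtr0_norm ?expR_gt0// ler_wpM2l// ler_expR.
apply: (le_trans (ler_norm _)); rewrite normrM ler_wpM2l//.
have := ler_norm M; have := ler_norm (- m); have := normr_ge0 m; have := normr_ge0 M.
rewrite normrN ler_norml => *; apply/andP; split; lra.
Qed.

Lemma frac_differentiable_expsum (s : seq (R * R)) (h : R -> R) (q a : R) :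
  0 < q < alpha -> 0 < a < 1 -> (forall x, 0 <= x <= 1 -> h x = expsum s (rough x)) ->
  locally_frac_differentiable q h a.
Proof.
move=> /andP[q0 qa] /andP[a0 a1] hE.
have [_ al1] := andP alpha01.
(* By monotonicity [rough] maps [0, 1] into [rough 0, rough 1], where the exponential sum is
   Lipschitz. *)
have [L L0 hL] := expsum_lipschitz s (rough 0) (rough 1).
have E0 : 0 <= wsum (fun=> 1) :> R by exact: wsum1_ge0.
apply: (@locally_frac_differentiable_holder _ alpha q (L * wsum (fun=> 1)) a 1) => //.
  exact: mulr_ge0.
have r01 (x : R) : a <= x < 1 -> rough 0 <= rough x <= rough 1.
  move=> /andP[ax x1]; rewrite !(ltW (rough_increasing alpha01 _))//.
  exact: lt_le_trans ax.
move=> x y hx hy.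
have i01 (z : R) : a <= z < 1 -> 0 <= z <= 1.
  by move=> /andP[az z1]; rewrite (le_trans (ltW a0) az) ltW.
rewrite !hE ?i01//; apply: (le_trans (hL _ _ _ _)); rewrite ?r01//.
by rewrite -mulrA ler_wpM2l//; exact: rough_holder.
Qed.

Lemma nowhere_frac_differentiable_expsum (s : seq (R * R)) (h : R -> R) (q a : R) :
  ~ (forall x, expsum (expsum_deriv s) x = 0) ->
  alpha < q < 1 -> 0 < a < 1 -> (forall x, 0 <= x <= 1 -> h x = expsum s (rough x)) ->
  ~ locally_frac_differentiable q h a.
Proof.
move=> ds0 q1 /andP[a0 a1] hE [nd _].
have hE' x : a <= x < 1 -> h x = expsum s (rough x).
  by move=> /andP[ax x1]; apply: hE; rewrite (le_trans (ltW a0) ax) ltW.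
have [//|dp|dn] := right_signed_expsum (expsum_deriv s) (rough a).
  exact: (@not_frac_differentiable_comp _ _ h q a 1 (is_derive_expsum s)) nd.
(* When the derivative is negative on the right, the argument is run on the opposite functions. *)
have dN (u : R) : is_derive u (1 : R) (\- expsum s) ((\- expsum (expsum_deriv s)) u).
  exact: is_deriveN (is_derive_expsum s u).
have dnN : \forall u \near (rough a)^'+, 0 < (\- expsum (expsum_deriv s)) u.
  by apply: filterS dn => u du; rewrite /= oppr_gt0.
have hEN x : a <= x < 1 -> (\- h) x = (\- expsum s) (rough x).
  by move=> /hE' /= ->.
apply: (not_frac_differentiable_comp dN dnN a1 hEN q1).
apply: filterS2 (nbhs_right_gt a) nd => x ax /(RL_derivableN ax).
rewrite (_ : \- _ = (fun y => (\- h) y - (\- h) a)) => [//|].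
by apply/funext => y /=; rewrite opprB opprK addrC.
Qed.

End rough_compositions.

(** * Polynomials in the generators as exponential sums *)

Section monomials.
Context {R : realType} (k : nat).
Implicit Types (c : 'I_k -> R) (m : mpoly.multinom k) (P : mpoly.mpoly k R).

Definition mnm_exponent c m : R :=
  \sum_i (mpoly.fun_of_multinom m i)%:R * exponent (c i).

Lemma mnm_exponent_gt0 c m : m != @mpoly.mnm0 k -> 0 < mnm_exponent c m.
Proof.
move=> m0; rewrite lt_def sumr_ge0 ?andbT; last first.
  by move=> i _; rewrite mulr_ge0// ltW// exponent_gt0.
apply: contra m0 => /eqP; rewrite /mnm_exponent => /eqP.
rewrite psumr_eq0 => [/allP h|i _]; last by rewrite mulr_ge0// ltW// exponent_gt0.
apply/eqP/mpoly.mnmP => i; rewrite mpoly.mnm0E.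
have := h i (mem_index_enum _); rewrite mulf_eq0 pnatr_eq0.
by rewrite (gt_eqF (exponent_gt0 _)) orbF => /eqP.
Qed.

(** The differences of multiplicities are the integer coefficients of a vanishing combination of
    exponents. *)
Lemma mnm_exponent_inj c : injective c -> injective (mnm_exponent c).
Proof.
move=> cinj m m' mm'; apply/mpoly.mnmP => i.
pose d (i : 'I_k) : int :=
  (mpoly.fun_of_multinom m i)%:Z - (mpoly.fun_of_multinom m' i)%:Z.
suff : d i = 0 by move/eqP; rewrite subr_eq0 eqz_nat => /eqP.
apply: (exponent_independent cinj).
rewrite (eq_bigr (fun i => (mpoly.fun_of_multinom m i)%:R * exponent (c i)
  - (mpoly.fun_of_multinom m' i)%:R * exponent (c i))).
  by rewrite sumrB [X in X - _]mm' subrr.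
by move=> j _; rewrite /d rmorphB/= mulrBl.
Qed.

Definition mpoly_expsum c P : seq (R * R) :=
  [seq (mpoly.mcoeff m P, mnm_exponent c m) | m <- mpoly.msupp P].

Lemma meval_expR c P (x : R) :
  mpoly.meval (fun i => expR (exponent (c i) * x)) P = expsum (mpoly_expsum c P) x.
Proof.
rewrite mpoly.mevalE /expsum [RHS]big_map; apply: eq_bigr => m _ /=; congr (_ * _).
rewrite /mnm_exponent mulr_suml expR_sum; apply: eq_bigr => i _.
by rewrite -expRM_natl mulrA.
Qed.

(** Without constant term, the support omits the trivial monomial, and all others have positive
    exponent. *)
Lemma mpoly_expsum_gt0 c P : no_constant_term P ->
  all (fun p => 0 < p.2) (mpoly_expsum c P).
Proof.
move=> P0; apply/allP => p /mapP[m mP ->] /=; apply: mnm_exponent_gt0.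
by apply: contraTneq mP => ->; rewrite -mpoly.mcoeff_eq0; apply/eqP.
Qed.

Lemma mpoly_expsum_eq0 c P : injective c ->
  (forall x, expsum (mpoly_expsum c P) x = 0) -> P = 0.
Proof.
move=> cinj /expsum_eq0 h; apply/eqP; rewrite -mpoly.msupp_eq0 -size_eq0.
rewrite -(size_map (fun m => (mpoly.mcoeff m P, mnm_exponent c m))) size_eq0; apply/eqP.
apply: h.
  rewrite /unzip2 -map_comp map_inj_uniq ?mpoly.msupp_uniq//.
  exact: mnm_exponent_inj.
by apply/allP => p /mapP[m mP ->] /=; rewrite -mpoly.mcoeff_msupp.
Qed.

End monomials.

(* ['valL_0 f] extends f : [0, 1] -> R to R by 0; since the interval I is an
   open subset of [0, 1], the values outside of [0, 1] play no role. *)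
Theorem theorem4p9 (R : realType) (alpha : R) (halpha : 0 < alpha < 1) :
  exists I : set R,
    [/\ is_interval I, open I, I !=set0 & I `<=` `[0, 1]] /\
    strongly_algebrable [set: R]
      [set f : set_type (`[0, 1]%classic : set R) -> R |
         (forall q : R, alpha < q < 1 ->
            nowhere_frac_differentiable_on q ('valL_0 f) I) /\
         (forall q : R, 0 < q < alpha ->
            frac_differentiable_on q ('valL_0 f) I)].
Proof.
exists `]0, 1[%classic; split.
  split.
  - exact: interval_is_interval.
  - exact: itv_open.
  - by exists 2^-1; rewrite /= in_itv/= invr_gt0 ltr0n invf_lt1 ?ltr1n.
  - by apply: subset_itvW.
pose T := set_type (`[0, 1]%classic : set R).
pose gen (c : R) : T -> R := fun t => expR (exponent c * rough alpha (val t)).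
have inT (x : R) : 0 <= x <= 1 -> exists t : T, val t = x.
  move=> x01; have xT : x \in (`[0, 1]%classic : set R) by rewrite inE/= in_itv.
  by exists (exist _ x xT).
have rinc := rough_increasing halpha.
have expinj : injective (@exponent R).
  move=> c c' cc'; apply/eqP/negPn/negP => ncc'.
  (* Injectivity is independence for two exponents with coefficients 1 and -1. *)
  pose d (i : 'I_2) : R := if i == ord0 then c else c'.
  have dinj : injective d.
    move=> i j; rewrite /d; have [->|i0] := eqVneq i ord0;
      have [->|j0] := eqVneq j ord0 => //.
    + by move=> e; rewrite e eqxx in ncc'.
    + by move=> e; rewrite e eqxx in ncc'.
    + by move=> _; apply/val_inj; case: i i0 => [[|[]]]//= ? _;
      case: j j0 => [[|[]]]//=.
  have := @exponent_independent R 2 d (fun i => if i == ord0 then 1 else - 1) dinj.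
  rewrite !big_ord_recl big_ord0/= /d/= cc' mul1r addr0 mulN1r subrr.
  by move=> /(_ erefl ord0).
have geninj : injective gen.
  move=> c c' cc'; apply: expinj.
  (* Subtracting the equalities at 0 and 1 leaves the nonzero factor rough 1 - rough 0, which
     cancels. *)
  have [|t0 t0E] := inT 0; first by rewrite lexx ler01.
  have [|t1 t1E] := inT 1; first by rewrite lexx ler01.
  have h (t : T) : exponent c * rough alpha (val t) = exponent c' * rough alpha (val t).
    by have /expR_inj := congr1 (fun g => g t) cc'.
  have r01 : rough alpha 1 - rough alpha 0 != 0 by rewrite subr_eq0 gt_eqF// rinc.
  have := h t0; rewrite t0E => h0; have := h t1; rewrite t1E => h1.
  by apply: (mulIf r01); rewrite !mulrBr h0 h1.
have genE (k : nat) (P : mpoly.mpoly k R) (c : 'I_k -> R) (t : T) :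
    poly_fun P (fun i => gen (c i)) t = expsum (mpoly_expsum c P) (rough alpha (val t)).
  exact: meval_expR.
have genX (k : nat) (x : 'I_k -> T -> R) : (forall i, range gen (x i)) ->
    exists c : 'I_k -> R, x = (fun i => gen (c i)).
  move=> hx; have h i : {c | gen c = x i} by apply: cid; have [c _ <-] := hx i;
    exists c.
  exists (fun i => sval (h i)); apply/funext => i; exact/esym/(svalP (h i)).
exists (range gen); split.
- by apply: inj_card_eq => c c' _ _; exact: geninj.
- move=> _ [k [P [x [P0 /genX[c ->] ->]]]].
  (* The negative result needs a derivative that is not identically zero; when it is, the element of
     the algebra is itself 0. *)
  have [d0|d0] := pselect (forall y, expsum (expsum_deriv (mpoly_expsum c P)) y = 0).
    right; apply/funext => t; rewrite genE.
    exact: expsum_deriv_eq0 (mpoly_expsum_gt0 c P0) d0 _.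
  have hE x' : 0 <= x' <= 1 -> 'valL_0 (poly_fun P (fun i => gen (c i))) x' =
      expsum (mpoly_expsum c P) (rough alpha x').
    move=> /inT[t <-]; rewrite -genE.
    exact: (congr1 (fun g => g (poly_fun P (fun i => gen (c i))) t) (sigL_valL 0)).
  left; split => q hq a; rewrite /= in_itv/= => a01.
    by have := nowhere_frac_differentiable_expsum halpha d0 hq a01 hE.
  by have := frac_differentiable_expsum halpha hq a01 hE.
- move=> k P x P0 /genX[c xE] xinj; split => [P_eq0|->]; last first.
    by apply/funext => t; rewrite /poly_fun mpoly.meval0.
  have cinj : injective c.
    by move=> i j cij; apply: xinj; rewrite xE cij.
  apply: (mpoly_expsum_eq0 cinj).
  have r0 (t : T) : expsum (mpoly_expsum c P) (rough alpha (val t)) = 0.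
    by rewrite -genE -xE P_eq0.
  have rcont : rough alpha t @[t --> 0^'+] --> rough alpha 0.
    by apply: cvg_at_right_filter; exact: rough_continuous.
  (* The sum is only known to vanish on values of [rough]. Such values occur arbitrarily close to
     [rough 0] on its right, which excludes both strict signs in [right_signed_expsum] and leaves
     vanishing everywhere. *)
  have near0 (Q : R -> Prop) : (\forall u \near (rough alpha 0)^'+, Q u) ->
      exists t : T, Q (rough alpha (val t)).
    move=> /near_at_right_ex[e e0 hQ].
    have lt_e : rough alpha 0 < rough alpha 0 + e by rewrite ltrDl.
    have : \forall t \near (0 :
      R)^'+, [/\ 0 < t, t < 1 & rough alpha t < rough alpha 0 + e].
      near=> t; split; near: t.
      - exact: nbhs_right_gt.
      - exact: nbhs_right_lt.
      - exact: rcont (lt_nbhsl lt_e).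
    move/filter_ex => [t [t0 t1 te]].
    have [|u uE] := inT t; first by rewrite !ltW.
    by exists u; apply: hQ; rewrite uE te rinc.
  have [//|/near0[t]|/near0[t]] :=
    right_signed_expsum (mpoly_expsum c P) (rough alpha 0).
    by rewrite r0 ltxx.
  by rewrite r0 ltxx.
Unshelve. all: by end_near.
Qed.
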